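(* Let $n\ge2$ and let $\mathcal M=\mathrm{CM}(D_n,X,p)$ be a regular Cayley map with associated power function $\pi$. Then (1) $\mathrm{Ker}(\pi)$ is a dihedral subgroup of $D_n$, i.e. $\mathrm{Ker}(\pi)\cap(D_n\setminus C_n)\neq\emptyset$; and (2) either $\mathcal M$ is the embedding of the octahedron into the sphere and $|\mathrm{Ker}(\pi)|=2$, or $|\mathrm{Ker}(\pi)|\ge4$.
   Context: $D_n=\langle a,b\mid a^n=b^2=baba=1\rangle$ is the dihedral group of order $2n$, $C_n=\langle a\rangle$. For a finite group $G$, a generating subset $X\subseteq G$ with $X=X^{-1}$, $1_G\notin X$, and a cyclic permutation $p$ of $X$, the Cayley map $\mathrm{CM}(G,X,p)$ is the map with underlying Cayley graph $\mathrm{Cay}(G,X)$ (vertices $G$, edges $\{g,gx\}$) and rotation $(g,gx)\mapsto(g,g\,p(x))$; it is regular if its automorphism group (dart permutations commuting with rotation and dart-reversal) is transitive on darts. A skew-morphism of $G$ is a permutation $\psi$ of $G$ fixing $1_G$ with a function $\pi:G\to\{1,\dots,r\}$ ($r$ the order of $\psi$) such that $\psi(gh)=\psi(g)\psi^{\pi(g)}(h)$ for all $g,h$. A Cayley map is regular iff some skew-morphism $\psi$ agrees with $p$ on $X$; this unique $\psi$ and its power function $\pi$ are the associated skew-morphism and power function. $\mathrm{Ker}(\pi)=\{g:\pi(g)=1\}$. *)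

(* Defs.v *)
From HB Require Import structures.
From mathcomp Require Import all_boot all_fingroup all_solvable.

Set Implicit Arguments.
Unset Strict Implicit.
Unset Printing Implicit Defensive.

Local Open Scope group_scope.

(* The whole group on gT is < a, b | a^n = b^2 = baba = 1 >, with a and b the
   distinguished generators: they satisfy the relations and generate, and no
   finite group generated by such a pair is larger. *)
Definition dihedral_presentation (gT : finGroupType) (n : nat) (a b : gT) : Prop :=
  [/\ a ^+ n = 1, b ^+ 2 = 1, b * a * b * a = 1,
      <<[set a; b]>> = [set: gT]
    & [set: gT] \isog Grp (x : y : x ^+ n, y ^+ 2, y * x * y * x)].

(* A permutation of X is encoded as a permutation of gT fixing every element
   outside X. *)
Definition cyclic_perm_of (gT : finGroupType) (X : {set gT}) (p : {perm gT}) : Prop :=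
  perm_on X p /\ {in X, forall x, porbit p x = X}.

Record cayley_map (gT : finGroupType) := CayleyMap {
  cm_set : {set gT};
  cm_perm : {perm gT};
  cm_gen : <<cm_set>> = [set: gT];
  cm_inv : cm_set^-1 = cm_set;
  cm_not1 : 1 \notin cm_set;
  cm_cyclic : cyclic_perm_of cm_set cm_perm
}.

Section CayleyMap.

Variables (gT : finGroupType) (M : cayley_map gT).

Definition cm_adj : rel gT := [rel g h | g^-1 * h \in cm_set M].

(* The dart (g, gx), x in X, is the pair of its initial and terminal vertex. *)
Definition cm_dart := {d : gT * gT | cm_adj d.1 d.2}.

Lemma cm_rot_subproof (d : cm_dart) :
  cm_adj (val d).1 ((val d).1 * cm_perm M ((val d).1^-1 * (val d).2)).
Proof.
case: d => [[g h] gh]; rewrite /cm_adj /= mulKg.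
by case: (cm_cyclic M) => pX _; rewrite perm_closed.
Qed.

Definition cm_rot_fun (d : cm_dart) : cm_dart :=
  exist (fun d : gT * gT => cm_adj d.1 d.2) (_, _) (cm_rot_subproof d).

Lemma cm_rot_inj : injective cm_rot_fun.
Proof.
move=> [[g h] gh] [[g' h'] gh'] /(congr1 val) /= [eqg eqh].
apply: val_inj; rewrite /= -eqg in eqh *.
by move: eqh => /mulgI/perm_inj/mulgI ->.
Qed.

Definition cm_rot : {perm cm_dart} := perm cm_rot_inj.

Lemma cm_rev_subproof (d : cm_dart) : cm_adj (val d).2 (val d).1.
Proof.
case: d => [[g h] gh].
by rewrite /cm_adj /= -(cm_inv M) inE invMg invgK.
Qed.

Definition cm_rev_fun (d : cm_dart) : cm_dart :=
  exist (fun d : gT * gT => cm_adj d.1 d.2) (_, _) (cm_rev_subproof d).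

Lemma cm_rev_inj : injective cm_rev_fun.
Proof.
move=> [[g h] gh] [[g' h'] gh'] /(congr1 val) /= [eqh eqg].
by apply: val_inj; rewrite /= eqh eqg.
Qed.

Definition cm_rev : {perm cm_dart} := perm cm_rev_inj.

Definition cm_aut : {group {perm cm_dart}} := 'C([set cm_rot; cm_rev])%G.

Definition cm_regular : Prop := [transitive cm_aut, on [set: cm_dart] | 'P].

(* The supporting surface is orientable, and connected because X generates, so
   it is the sphere iff V - E + F = 2. Vertices, edges and faces are the orbits
   of the rotation, of the dart reversal and of their product. *)
Definition cm_spherical : Prop :=
  (#|porbits cm_rot| + #|porbits (cm_rev * cm_rot)| = #|porbits cm_rev| + 2)%N.

(* The vertices of the octahedron are the unit vectors +e_i, -e_i, i < 3;
   two of them are adjacent iff they lie on different axes. *)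
Definition octahedron_adj : rel ('I_3 * bool) := [rel u v | u.1 != v.1].

Definition cm_spherical_octahedron : Prop :=
  cm_spherical /\
  exists2 f : gT -> 'I_3 * bool, bijective f &
    forall g h, cm_adj g h = octahedron_adj (f g) (f h).

End CayleyMap.

Definition skew_morphism (gT : finGroupType) (psi : {perm gT}) (pw : gT -> nat) : Prop :=
  [/\ psi 1 = 1,
      forall g, (1 <= pw g <= #[psi])%N
    & forall g h, psi (g * h) = psi g * (psi ^+ pw g) h].

Definition associated_skew_morphism (gT : finGroupType) (M : cayley_map gT)
    (psi : {perm gT}) (pw : gT -> nat) : Prop :=
  skew_morphism psi pw /\ {in cm_set M, psi =1 cm_perm M}.

Definition power_ker (gT : finGroupType) (pw : gT -> nat) : {set gT} :=
  [set g | pw g == 1%N].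

(* Main.v *)
Require Import Defs.
From mathcomp Require Import all_boot all_fingroup all_solvable zify.

(* Write H = <[psi]>, r = #[psi] = #|X|, n = #|C_n|. The map psi(g)^-1 psi(g _)
   is the element psi ^+ pi(g) of H; it determines g up to the kernel K of pi
   and is never 1, so #|D_n : K| < r. Fixed points of an element of H form a
   subgroup, hence H is semiregular on X. If x and psi(x) are both involutions
   of X, then x lies in K.

   Suppose K is contained in C_n. If psi moves K, then K is generated by the
   central involution, and some nontrivial element of H fixes all conjugates
   of a reflection, at least n elements, leaving fewer than n + 1 for X.
   Otherwise K is normal in D_n H and one argues by induction on D_n / K: the
   elements of H fixing all cosets of K are automorphisms of D_n, so for a
   reflection g whose image is in the kernel of the quotient, psi ^+ (pi(g) - 1)
   is the unique involution of H; hence the kernel of the quotient has order 2,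
   the quotient is the octahedron, and two consecutive elements of X are
   reflections, which puts a reflection in K.

   Suppose K = {1, k} with k a reflection. For an involution x of X, the map
   c |-> psi ^+ pi(c) (x) sends the c in C_n not conjugating x to k injectively
   to non-involutions of X. Counting shows that X contains every rotation of
   order at least 3 and no rotation of order 2; each remaining orbit of psi has
   fewer than r elements, so it lies in a small subgroup of fixed points, and
   this forces n = 3 and r = 4. *)

Set Implicit Arguments.
Unset Strict Implicit.
Unset Printing Implicit Defensive.

Local Open Scope group_scope.

(** * Skew-morphisms as permutations, and their generating orbits *)

Section SkewPerm.

Variable gT : finGroupType.
Implicit Types (g h k x y : gT) (psi s w : {perm gT}).

Definition lmul g : {perm gT} := perm (mulgI g).

(* For a skew-morphism psi with power function pi, skew_cof psi g is the
   permutation psi ^+ pi g, so that no exponent has to be reduced modulo the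
   order of psi. *)
Definition skew_cof s g : {perm gT} := lmul g * s * (lmul (s g))^-1.

Lemma lmulE g h : lmul g h = g * h.
Proof. by rewrite permE. Qed.

Lemma skew_cofE s g h : skew_cof s g h = (s g)^-1 * s (g * h).
Proof.
rewrite /skew_cof !permM lmulE; apply: (@perm_inj _ (lmul (s g))).
by rewrite permKV lmulE mulKVg.
Qed.

Lemma skew_cofK s g h : s (g * h) = s g * skew_cof s g h.
Proof. by rewrite skew_cofE mulKVg. Qed.

Lemma skew_cofM s w g : skew_cof (s * w) g = skew_cof s g * skew_cof w (s g).
Proof. by rewrite /skew_cof permM !mulgA mulgKV. Qed.

Definition skew_ker psi := [set g | skew_cof psi g == psi].

Lemma skew_kerP psi g : psi 1 = 1 ->
  reflect (forall h, psi (g * h) = psi g * psi h) (g \in skew_ker psi).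
Proof.
move=> psi1; rewrite inE; apply: (iffP eqP) => [eq_g h | mor_g].
  by rewrite skew_cofK eq_g.
by apply/permP=> h; rewrite skew_cofE mor_g mulKg.
Qed.

Lemma skew_ker_group_set psi : psi 1 = 1 -> group_set (skew_ker psi).
Proof.
move=> psi1; apply/group_setP; split=> [|g h /(skew_kerP _ psi1) Hg /(skew_kerP _ psi1) Hh].
  by apply/skew_kerP=> // h; rewrite psi1 !mul1g.
by apply/skew_kerP=> // u; rewrite -mulgA (Hg (h * u)) Hh Hg mulgA.
Qed.

(** If the cofactors agree, [psi (g * v) = psi g * (psi h)^-1 * psi (h * v)] for all [v]; taking
    [v = h^-1] identifies the prefactor as [psi (g * h^-1)]. *)
Lemma skew_cof_eq psi g h : psi 1 = 1 ->
  (skew_cof psi g == skew_cof psi h) = (g * h^-1 \in skew_ker psi).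
Proof.
move=> psi1; apply/eqP/skew_kerP => // [eq_gh u | mor_k].
  have cof v : psi (g * v) = psi g * (psi h)^-1 * psi (h * v).
    by rewrite !skew_cofK eq_gh !mulgA mulgKV.
  have:= cof h^-1; rewrite mulgV psi1 mulg1 => ->.
  by have:= cof (h^-1 * u); rewrite mulKVg mulgA.
apply/permP=> u; rewrite !skew_cofE.
have ->: g * u = g * h^-1 * (h * u) by rewrite !mulgA mulgKV.
have {1}->: g = g * h^-1 * h by rewrite mulgKV.
by rewrite !mor_k invMg -!mulgA mulKg.
Qed.

(** Membership in [<[psi]>] replaces a choice of exponents, so the notion passes to quotients, where
    the order of [psi] may drop. *)
Definition skew_perm psi :=
  psi 1 = 1 /\ forall g, skew_cof psi g \in <[psi]>.

Definition generating_orbit psi (X : {set gT}) :=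
  [/\ <<X>> = [set: gT], 1 \notin X
    & {in X, forall x, porbit psi x = X}].

Section Theory.

Variables (psi : {perm gT}) (X : {set gT}).
Hypothesis psi_skew : skew_perm psi.
Hypothesis X_orbit : generating_orbit psi X.

Let psi1 : psi 1 = 1. Proof. by case: psi_skew. Qed.
Let X_gen : <<X>> = [set: gT]. Proof. by case: X_orbit. Qed.
Let porbitX x : x \in X -> porbit psi x = X.
Proof. by case: X_orbit => _ _; apply. Qed.

Lemma cycle_perm_ind (P : {perm gT} -> Prop) :
  P 1 -> (forall s, s \in <[psi]> -> P s -> P (s * psi)) ->
  forall s, s \in <[psi]> -> P s.
Proof.
move=> P1 PM s /cycleP[i ->]; elim: i => [|i IHi]; first by rewrite expg0.
by rewrite expgSr; apply: PM => //; apply: mem_cycle.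
Qed.

Lemma cycle_comm s w : s \in <[psi]> -> w \in <[psi]> -> s * w = w * s.
Proof. by move=> Hs Hw; apply: (centsP (cycle_abelian psi)). Qed.

Lemma cycle_permC s w x : s \in <[psi]> -> w \in <[psi]> -> s (w x) = w (s x).
Proof. by move=> Hs Hw; rewrite -!permM cycle_comm. Qed.

Lemma skew_perm1 s : s \in <[psi]> -> s 1 = 1.
Proof. by elim/cycle_perm_ind=> [|w _ IHw]; rewrite ?perm1 // permM IHw. Qed.

Lemma skew_cof_cycle s g : s \in <[psi]> -> skew_cof s g \in <[psi]>.
Proof.
elim/cycle_perm_ind=> [|w _ IHw].
  by rewrite /skew_cof mulg1 perm1 mulgV group1.
by rewrite skew_cofM groupM //; case: psi_skew.
Qed.

Definition fix_set s := [set g | s g == g].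

(* L_g^-1 s L_g lies in the cyclic group <[psi]> and has the order of s. *)
Lemma fix_set_group_set s : s \in <[psi]> -> group_set (fix_set s).
Proof.
move=> Hs; apply/group_setP; split=> [|g h]; first by rewrite inE skew_perm1.
rewrite !inE => /eqP sg /eqP sh.
have Hc := skew_cof_cycle g Hs.
have: skew_cof s g \in <[s]>.
  rewrite -cycle_subG; have ->: <[skew_cof s g]> = <[s]>; last exact: subxx.
  apply/eqP; rewrite (eq_subG_cyclic (cycle_cyclic psi)) ?cycle_subG //.
  rewrite -!orderE; have ->: skew_cof s g = s ^ (lmul g)^-1.
    by rewrite /skew_cof sg conjgE invgK mulgA.
  by rewrite orderJ.
case/cycleP=> i ci; rewrite skew_cofK sg ci; apply/eqP; congr (_ * _).
by elim: i {ci} => [|i IHi]; rewrite ?expg0 ?perm1 // expgSr permM IHi.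
Qed.

Lemma fix_set_invariant s w g :
  s \in <[psi]> -> w \in <[psi]> -> g \in fix_set s -> w g \in fix_set s.
Proof. by move=> Hs Hw; rewrite !inE cycle_permC // => /eqP->. Qed.

Lemma generating_orbit_invariant s x : s \in <[psi]> -> x \in X -> s x \in X.
Proof.
by move=> /cycleP[i ->] Xx; rewrite -(porbitX Xx) mem_porbit.
Qed.

Lemma generating_orbitE x y : x \in X -> y \in X -> exists2 s, s \in <[psi]> & y = s x.
Proof.
move=> Xx; rewrite -(porbitX Xx) => /porbitP[i ->].
by exists (psi ^+ i); rewrite ?mem_cycle.
Qed.

(** The fixed points of [s] form a subgroup, stable under the abelian group [<[psi]>]; it contains
    the whole orbit [X], which generates. *)
Lemma orbit_semiregular s x : s \in <[psi]> -> x \in X -> s x = x -> s = 1.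
Proof.
move=> Hs Xx sx; pose F := Group (fix_set_group_set Hs).
have: <<X>> \subset F.
  rewrite gen_subG; apply/subsetP=> y Xy; have [w Hw ->] := generating_orbitE Xx Xy.
  by apply: fix_set_invariant => //; rewrite inE sx.
rewrite X_gen => /subsetP fixT; apply/permP=> g.
by have:= fixT g (in_setT g); rewrite inE perm1 => /eqP.
Qed.

Lemma generating_orbit_inj s w x :
  s \in <[psi]> -> w \in <[psi]> -> x \in X -> s x = w x -> s = w.
Proof.
move=> Hs Hw Xx eq_sw; apply/eqP; rewrite eq_mulgV1; apply/eqP.
apply: (@orbit_semiregular _ x); rewrite ?groupM ?groupV //.
by rewrite permM eq_sw permK.
Qed.

Lemma fix_setX s x : s \in <[psi]> -> s != 1 -> x \in X -> x \notin fix_set s.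
Proof.
move=> Hs sn1 Xx; rewrite inE; apply: contra sn1 => /eqP sx.
exact/eqP/(orbit_semiregular Hs Xx).
Qed.

Lemma orbit_neq0 : [set: gT] != 1 -> exists x, x \in X.
Proof.
move=> ntG; have [X0|[x Xx]] := set_0Vmem X; last by exists x.
by rewrite -X_gen X0 gen0 eqxx in ntG.
Qed.

Lemma card_generating_orbit : [set: gT] != 1 -> #|X| = #[psi].
Proof.
case/orbit_neq0=> x Xx; rewrite orderE.
have inj: {in <[psi]> &, injective (fun s : {perm gT} => s x)}.
  by move=> s w Hs Hw; apply: generating_orbit_inj.
rewrite -(card_in_imset inj); apply: eq_card => y.
apply/idP/imsetP => [Xy | [s Hs ->]]; last exact: generating_orbit_invariant.
by have [s] := generating_orbitE Xx Xy; exists s.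
Qed.

(** Expanding [psi (x * x) = 1] shows that [skew_cof psi x] sends [x] to the inverse of [psi x],
    that is, to [psi x]; semiregularity identifies the two permutations. *)
Lemma consecutive_involutions x :
  x \in X -> x * x = 1 -> psi x * psi x = 1 -> x \in skew_ker psi.
Proof.
move=> Xx xx pxx; rewrite inE; apply/eqP.
have Hc := skew_cof_cycle x (cycle_id psi).
apply: (generating_orbit_inj Hc (cycle_id psi) Xx); apply: (mulgI (psi x)).
by rewrite -skew_cofK xx psi1 pxx.
Qed.

Lemma skew_cof_neq1 g : psi != 1 -> skew_cof psi g != 1.
Proof.
apply: contra => /eqP cof1.
have E u : psi (g * u) = psi g * u by rewrite skew_cofK cof1 perm1.
have psig : psi g = g.
  by have:= E g^-1; rewrite mulgV psi1 => /esym/eqP; rewrite -eq_mulgV1 => /eqP.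
by apply/eqP/permP=> u; rewrite perm1 -[u](mulKVg g) E psig.
Qed.

Definition cof_set := [set skew_cof psi g | g in [set: gT]].

(** By [skew_cof_eq] the fibres of [skew_cof psi] are the right cosets of the kernel. *)
Lemma card_cof_set : (#|cof_set| * #|skew_ker psi| = #|gT|)%N.
Proof.
rewrite -[#|gT|]cardsT -[RHS]sum1_card (partition_big_imset (skew_cof psi)) /=.
rewrite -sum_nat_const; apply: eq_bigr => s /imsetP[g _ ->]; rewrite sum1dep_card.
rewrite -(card_rcoset (skew_ker psi) g); apply: eq_card => h.
by rewrite mem_rcoset -skew_cof_eq // inE in_setT.
Qed.

Lemma card_cof_set_lt : [set: gT] != 1 -> psi != 1 -> (#|cof_set| < #|X|)%N.
Proof.
move=> ntG npsi; rewrite card_generating_orbit // orderE [X in (_ < X)%N](cardsD1 1) group1.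
apply: subset_leq_card; apply/subsetP=> s /imsetP[g _ ->].
by rewrite !inE skew_cof_neq1 // skew_cof_cycle // cycle_id.
Qed.

End Theory.

End SkewPerm.

(** * Dihedral groups through their rotation subgroup *)

Lemma cyclic_involution_unique (gT : finGroupType) (G : {group gT}) x y :
  cyclic G -> x \in G -> y \in G -> x * x = 1 -> y * y = 1 ->
  x != 1 -> y != 1 -> x = y.
Proof.
move=> cG Gx Gy xx yy nx ny.
have ord u : u * u = 1 -> u != 1 -> #[u] = 2.
  by move=> uu nu; apply: nt_prime_order.
have: <[x]> == <[y]>.
  by rewrite (eq_subG_cyclic cG) ?cycle_subG // -!orderE !ord.
move/eqP=> eq_xy; have: x \in <[y]> by rewrite -eq_xy cycle_id.
by rewrite cycle2g ?ord // !inE (negPf nx) => /eqP.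
Qed.

Section Dihedral.

Variable gT : finGroupType.
Implicit Types (g h k x y c : gT).

(** A presentation-free form, inherited by quotients by normal subgroups inside [C]; it includes the
    Klein four-group. *)
Definition dihedral_over (C : {group gT}) :=
  [/\ cyclic C, #|gT| = #|C|.*2 & forall x, x \notin C -> x * x = 1].

Variable C : {group gT}.
Hypothesis dihC : dihedral_over C.

Let cycC : cyclic C. Proof. by case: dihC. Qed.
Let card_gT : #|gT| = #|C|.*2. Proof. by case: dihC. Qed.

Lemma refl_sqr x : x \notin C -> x * x = 1.
Proof. by case: dihC => _ _; apply. Qed.

Lemma refl_inv x : x \notin C -> x^-1 = x.
Proof. by move=> /refl_sqr xx; apply/eqP; rewrite eq_invg_mul xx. Qed.

Lemma refl_conj x c : x \notin C -> c \in C -> c * x = x * c^-1.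
Proof.
move=> Cx Cc; have Ccx : c * x \notin C by rewrite groupMl.
by rewrite -(refl_inv Ccx) invMg (refl_inv Cx).
Qed.

(** [C] and [x *: C] are disjoint and fill the group by cardinality, so [y] lies in [x *: C]. *)
Lemma refl_mul x y : x \notin C -> y \notin C -> x * y \in C.
Proof.
move=> Cx Cy; apply: contraR Cy => Cxy.
have sub: C :|: x *: C \subset [set: gT] by apply: subsetT.
have dis: C :&: x *: C = set0.
  apply/setP=> u; rewrite !inE mem_lcoset; apply/negP=> /andP[Cu].
  by rewrite groupMr // groupV (negPf Cx).
have: C :|: x *: C == [set: gT].
  by rewrite eqEcard sub cardsU dis cards0 subn0 card_lcoset cardsT card_gT addnn /=.
move/eqP/setP/(_ y); rewrite !inE mem_lcoset refl_inv //.
by rewrite (negPf Cxy) orbF.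
Qed.

Lemma central_involution z g : z \in C -> z * z = 1 -> z * g = g * z.
Proof.
move=> Cz zz; have [Cg|Cg] := boolP (g \in C).
  by apply: (centsP (cyclic_abelian cycC)).
have ->: z * g = g * z^-1 by apply: refl_conj.
by have/eqP->: z^-1 == z by rewrite eq_invg_mul zz.
Qed.

Definition invol_set := [set c in C | c * c == 1].

Lemma invol_setP c : reflect (c \in C /\ c * c = 1) (c \in invol_set).
Proof. by rewrite inE; apply: (iffP andP) => -[? /eqP]. Qed.

Lemma invol_set1 : 1 \in invol_set.
Proof. by rewrite inE group1 mulg1 eqxx. Qed.

Lemma sub_invol_set : invol_set \subset C.
Proof. by apply/subsetP=> c /invol_setP[]. Qed.

Lemma invol_setVmem :
  invol_set = [set 1] \/ exists2 z, z != 1 & invol_set = [set 1; z].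
Proof.
have [I0|[z]] := set_0Vmem (invol_set :\ 1).
  left; apply/setP=> c; apply/idP/set1P => [Ic|->]; last exact: invol_set1.
  apply/eqP; apply: contraT => nc.
  by have/setP/(_ c) := I0; rewrite in_setD1 nc Ic in_set0.
rewrite in_setD1 => /andP[nz /invol_setP[Cz zz]]; right; exists z => //.
apply/setP=> c; apply/invol_setP/set2P => [[Cc cc]|[]->].
- have [->|nc] := eqVneq c 1; first by left.
  by right; apply: (cyclic_involution_unique cycC).
- by rewrite group1 mulg1.
by [].
Qed.

Lemma odd_invol_set : invol_set = [set 1] -> odd #|C|.
Proof.
move=> I1; apply: contraT; rewrite -dvdn2 => /(Cauchy (isT : prime 2))[z Cz oz].
have: z \in invol_set by apply/invol_setP; rewrite -(expg_order z) oz.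
by rewrite I1 inE -order_eq1 oz.
Qed.

End Dihedral.

(** * Kernels of order two generated by a reflection *)

Lemma double_card_arith n r p q : (q + p = r -> p <= q -> n.*2 <= r + 2 ->
  1 < n -> r = n - 1 + p -> r = n.-1.*2)%N.
Proof. lia. Qed.

(** The bounds force [m = 3] and [n = 6]. *)
Lemma seven_card_arith n r m : (r = n - 2 + m -> n.*2 <= r + 5 -> m.*2 <= n ->
  n < r -> r = 7)%N.
Proof. lia. Qed.

Section DihedralSkew.

Variables (gT : finGroupType) (C : {group gT}) (psi : {perm gT}) (X : {set gT}).
Implicit Types (g h x y c : gT) (s w : {perm gT}).
Hypothesis dihC : dihedral_over C.
Hypothesis C_gt1 : (1 < #|C|)%N.
Hypothesis psi_skew : skew_perm psi.
Hypothesis X_orbit : generating_orbit psi X.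

Let psi1 : psi 1 = 1. Proof. by case: psi_skew. Qed.
Let X_gen : <<X>> = [set: gT]. Proof. by case: X_orbit. Qed.
Let X_not1 : 1 \notin X. Proof. by case: X_orbit. Qed.
Let cycC : cyclic C. Proof. by case: dihC. Qed.
Let card_gT : #|gT| = #|C|.*2. Proof. by case: dihC. Qed.
Let Hpsi : psi \in <[psi]>. Proof. exact: cycle_id. Qed.
Let Hcof g : skew_cof psi g \in <[psi]>. Proof. exact: skew_cof_cycle. Qed.

Lemma orbit_reflection : exists2 x, x \in X & x \notin C.
Proof.
apply/exists_inP; apply: contraT; rewrite negb_exists_in => /forall_inP XC.
have: [set: gT] \subset C.
  by rewrite -X_gen gen_subG; apply/subsetP=> x /XC; rewrite negbK.
move/subset_leq_card; rewrite cardsT card_gT -addnn; move: C_gt1; set n := #|C|; lia.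
Qed.

Lemma nontrivial_group : [set: gT] != 1.
Proof.
have [x Xx _] := orbit_reflection; apply: contraNneq X_not1 => G1.
by have: x \in [set: gT] := in_setT x; rewrite G1 => /set1P <-.
Qed.

(** With [psi = 1] the orbit would be a single reflection, generating a group of order 2, but the
    group has order at least 4. *)
Lemma skew_perm_neq1 : psi != 1.
Proof.
apply: contraTneq C_gt1 => psi_1; have [x Xx Cx] := orbit_reflection.
have: #[x] = #|gT|.
  rewrite orderE -cardsT -X_gen; congr #|pred_of_set _|; congr <<_>>.
  case: X_orbit => _ _ /(_ x Xx) <-; apply/setP=> y; rewrite inE psi_1.
  by apply/eqP/porbitP=> [->|[i ->]]; [exists 0; rewrite perm1 | rewrite expg1n perm1].
have: (#[x] %| 2)%N by rewrite order_dvdn expgS expg1 (refl_sqr dihC Cx).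
move/(dvdn_leq (isT : (0 < 2)%N)); rewrite card_gT; lia.
Qed.

Lemma card_cof_set_ltX : (#|cof_set psi| < #|X|)%N.
Proof. exact: (card_cof_set_lt psi_skew X_orbit nontrivial_group skew_perm_neq1). Qed.

Lemma card_orbit_order : #|X| = #[psi].
Proof. exact: (card_generating_orbit psi_skew X_orbit nontrivial_group). Qed.

Section TwoElementKernel.

Variable k : gT.
Hypothesis Ck : k \notin C.
Hypothesis ker_k : skew_ker psi = [set 1; k].

Let card_cof : #|cof_set psi| = #|C|.
Proof.
have := card_cof_set psi_skew; rewrite ker_k cards2 card_gT.
have ->: 1 != k by apply: contraNneq Ck => <-; rewrite group1.
rewrite /=; lia.
Qed.

Let X_gtC : (#|C| < #|X|)%N.
Proof. by rewrite -card_cof card_cof_set_ltX. Qed.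

Let cof_C c d : c \in C -> d \in C -> skew_cof psi c = skew_cof psi d -> c = d.
Proof.
move=> Cc Cd /eqP; rewrite skew_cof_eq // ker_k => /set2P[]/eqP.
  by rewrite -eq_mulgV1 => /eqP.
by move/eqP=> def_k; case/negP: Ck; rewrite -def_k groupM ?groupV.
Qed.

(** Expanding [psi (g * x * x)] shows that the cofactors of [g] and [g * x] send [x] to mutually
    inverse elements. If these coincide, so do the cofactors, and [g * x * g^-1] lies in the
    kernel. *)
Let cof_involution x g : x \in X -> x * x = 1 ->
  skew_cof psi g x * skew_cof psi g x = 1 -> g * x = k * g.
Proof.
move=> Xx xx gx2.
have E : skew_cof psi g x * skew_cof psi (g * x) x = 1.
  apply: (mulgI (psi g)); rewrite mulgA -skew_cofK -skew_cofK.
  by rewrite -mulgA xx !mulg1.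
have: skew_cof psi (g * x) == skew_cof psi g.
  apply/eqP; apply: (generating_orbit_inj psi_skew X_orbit) Xx _ => //.
  by apply: (mulgI (skew_cof psi g x)); rewrite E gx2.
rewrite skew_cof_eq // ker_k => /set2P[]/eqP.
  rewrite -eq_mulgV1 -{2}[g]mulg1 => /eqP/mulgI x1.
  by rewrite x1 (negPf X_not1) in Xx.
by move/eqP <-; rewrite mulgKV.
Qed.

Let I := invol_set C.
Let A x := [set c in C | c * x == k * c].
Let NI := [set y in X | y * y != 1].

Let sub_NI : NI \subset C :\: I.
Proof.
apply/subsetP=> y; rewrite inE => /andP[Xy yy].
have Cy : y \in C by apply: contraR yy => /(refl_sqr dihC)->.
by rewrite inE Cy andbT; apply: contra yy => /invol_setP[_ ->].
Qed.

(** A rotation [c] conjugating [x] to [k] satisfies [c * c = k * x], so two of them differ by an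
    element of [I]. *)
Let card_A x : (#|A x| <= #|I|)%N.
Proof.
have [->|[c]] := set_0Vmem (A x); first by rewrite cards0.
rewrite inE => /andP[Cc /eqP cx].
have Cx : x \notin C by rewrite -(groupMl _ Cc) cx groupMr.
have sqA d : d \in C -> d * x = k * d -> d * d = k * x.
  move=> Cd dx; have: x * d^-1 = k * d by rewrite -(refl_conj dihC).
  move/(congr1 (fun u => u * d)); rewrite mulgKV => ->.
  by rewrite !mulgA (refl_sqr dihC Ck) mul1g.
rewrite -(card_lcoset I c); apply: subset_leq_card; apply/subsetP=> d.
rewrite inE mem_lcoset => /andP[Cd /eqP dx].
have cCd : commute (c^-1) d.
  by apply: (centsP (cyclic_abelian cycC)); rewrite ?groupV.
apply/invol_setP; rewrite groupM ?groupV //; split=> //.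
rewrite -mulgA [d * _]mulgA -cCd -!mulgA (sqA d) // -(sqA c) //.
by rewrite mulKg mulVg.
Qed.

Let imC x := [set skew_cof psi c x | c in C :\: A x].

(** Distinct rotations have distinct cofactors, so [#|C| - #|A x| <= #|NI| <= #|C| - #|I|]; as
    [#|A x| <= #|I|], equality holds throughout. *)
Let orbit_involution x : x \in X -> x * x = 1 ->
  [/\ imC x = NI, NI = C :\: I & #|A x| = #|I|].
Proof.
move=> Xx xx.
have sub_im : imC x \subset NI.
  apply/subsetP=> y /imsetP[c]; rewrite !inE => /andP[Ac Cc] ->.
  rewrite (generating_orbit_invariant X_orbit) //=; apply: contra Ac => /eqP.
  by move=> /(cof_involution Xx xx)->; rewrite Cc eqxx.
have card_im : #|imC x| = (#|C| - #|A x|)%N.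
  rewrite card_in_imset => [|c d]; last first.
    rewrite !inE => /andP[_ Cc] /andP[_ Cd] eq_cd; apply: cof_C => //.
    exact: (generating_orbit_inj psi_skew X_orbit) Xx eq_cd.
  by rewrite cardsD (setIidPr _) //; apply/subsetP=> c; rewrite inE => /andP[].
have cardCI : #|C :\: I| = (#|C| - #|I|)%N.
  by rewrite cardsD (setIidPr _) //; apply: sub_invol_set.
have le1 := subset_leq_card sub_im; have le2 := subset_leq_card sub_NI.
have leI : (#|I| <= #|C|)%N by apply: subset_leq_card; apply: sub_invol_set.
have leA := card_A x.
have eqA : #|A x| = #|I| by move: le1 le2; rewrite card_im cardCI; lia.
split=> //; apply/eqP.
  by rewrite eqEcard sub_im; move: le1 le2; rewrite card_im cardCI; lia.
by rewrite eqEcard sub_NI; move: le1 le2; rewrite card_im cardCI; lia.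
Qed.

Let NI_C : NI = C :\: I.
Proof.
by have [x Xx /(refl_sqr dihC) xx] := orbit_reflection; have [] := orbit_involution Xx xx.
Qed.

Let orbit_invol_conj x : x \in X -> x * x = 1 ->
  x \notin C /\ exists2 c, c \in C & c * x = k * c.
Proof.
move=> Xx xx; have [_ _ cardA] := orbit_involution Xx xx.
have: (0 < #|A x|)%N.
  by rewrite cardA; apply/card_gt0P; exists 1; apply: invol_set1.
case/card_gt0P=> c; rewrite inE => /andP[Cc /eqP cx].
by split; [rewrite -(groupMl _ Cc) cx groupMr | exists c].
Qed.

Let orbitC : X :&: C = C :\: I.
Proof.
apply/setP=> c; rewrite -NI_C !inE; apply/andP/andP=> -[Xc].
  move=> Cc; split=> //; apply: contraTneq Cc => cc.
  by have [] := orbit_invol_conj Xc cc.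
by move=> cc; split=> //; apply: contraR cc => /(refl_sqr dihC)->.
Qed.

Let card_X : #|X| = (#|C| - #|I| + #|X :\: C|)%N.
Proof.
by rewrite -(cardsID C X) orbitC cardsD (setIidPr _) // sub_invol_set.
Qed.

(** The orbit of [y] avoids [1] and [X], so its length [j] satisfies
    [j + #|X| + 1 <= 2 #|C| < 2 #|X|]; hence [j] is less than the order of [psi]. *)
Let outside_fix y : y \notin X -> y != 1 ->
  exists2 s, s \in <[psi]> /\ s != 1 & y \in fix_set s.
Proof.
move=> Xy ny; pose j := #|porbit psi y|.
exists (psi ^+ j); last first.
  by rewrite inE; apply/eqP; rewrite /j permX iter_porbit.
split; first exact: mem_cycle.
rewrite -order_dvdn; apply/negP=> /dvdn_leq; rewrite -card_orbit_order.
have j0 : (0 < j)%N by apply/card_gt0P; exists y; apply: porbit_id.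
move/(_ j0); apply/negP; rewrite -ltnNge.
have: (j + #|1%g |: X| <= #|gT|)%N.
  rewrite -cardsT -(cardsID (1 |: X) [set: gT]) setTI addnC leq_add2l setTD.
  apply: subset_leq_card; apply/subsetP=> _ /porbitP[i ->].
  rewrite !inE negb_or; apply/andP; split.
    apply: contra ny => /eqP/(canRL (permK _)).
    by rewrite (skew_perm1 psi_skew) ?groupV ?mem_cycle // => ->.
  apply: contra Xy => Xs.
  by rewrite -(permK (psi ^+ i) y) (generating_orbit_invariant X_orbit) ?groupV ?mem_cycle.
rewrite cardsU1 X_not1 card_gT; move: X_gtC.
set n := #|C|; set r := #|X|; lia.
Qed.

Let fix_set_C s c : s \in <[psi]> -> s != 1 -> c \in fix_set s -> c \in C ->
  c \in I.
Proof.
move=> Hs ns sc Cc; apply: contraLR sc => Ic; apply: (fix_setX psi_skew X_orbit) => //.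
have: c \in X :&: C by rewrite orbitC inE Ic.
by rewrite inE => /andP[].
Qed.


Let fix_set_mul s y u : s \in <[psi]> -> s != 1 -> y \in fix_set s ->
  u \in fix_set s -> y \notin C -> u \notin C -> y * u \in fix_set s :&: I.
Proof.
move=> Hs ns sy su Cy Cu; pose F := Group (fix_set_group_set psi_skew Hs).
have Fyu : y * u \in fix_set s by apply: (@groupM _ F).
by rewrite inE Fyu; apply: fix_set_C Fyu (refl_mul dihC Cy Cu).
Qed.

Let refl_mul1 y u : y \notin C -> y * u = 1 -> u = y.
Proof. by move=> Cy /eqP; rewrite -eq_invg_mul (refl_inv dihC Cy) => /eqP. Qed.

Let psi_eq1 y : psi y = 1 -> y = 1.
Proof. by move=> py; apply: (@perm_inj _ psi); rewrite py psi1. Qed.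

Let kk : k * k = 1. Proof. exact: (refl_sqr dihC Ck). Qed.
Let k_neq1 : k != 1. Proof. by apply: contraNneq Ck => ->; apply: group1. Qed.
Let ker_kM h : psi (k * h) = psi k * psi h.
Proof. by move: h; apply/skew_kerP=> //; rewrite ker_k !inE eqxx orbT. Qed.

Let ker_orbit x : x \in X -> x \in skew_ker psi -> x = k.
Proof.
by move=> Xx; rewrite ker_k => /set2P[x1|//]; rewrite x1 (negPf X_not1) in Xx.
Qed.

(** By [orbit_involution], a [w] outside [cof_set psi] sends the involutions [k] and [psi k] to
    involutions. So [w k] and [psi (w k)] are consecutive involutions, whence [w k = k] and [w = 1]:
    only [1] is added to the [#|C|] cofactors. *)
Let orbit_at_k : k \in X -> #|X| = #|C|.+1.
Proof.
move=> Xk; have tt : psi k * psi k = 1 by rewrite -ker_kM kk.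
have Xt : psi k \in X by rewrite (generating_orbit_invariant X_orbit).
have invol x w : x \in X -> x * x = 1 -> w \in <[psi]> -> w \notin cof_set psi ->
    w x * w x = 1.
  move=> Xx xx Hw cw; have [im_x _ _] := orbit_involution Xx xx.
  apply/eqP; apply: contraR cw => wxx.
  have: w x \in imC x.
    by rewrite im_x inE wxx andbT (generating_orbit_invariant X_orbit).
  case/imsetP=> c _ /(generating_orbit_inj psi_skew X_orbit Hw (Hcof c) Xx) ->.
  exact: imset_f.
apply/eqP; rewrite eqn_leq X_gtC andbT card_orbit_order orderE -card_cof.
rewrite -addn1 addnC -[1%N](cards1 (1 : {perm gT})).
apply: leq_trans (leq_card_setU _ _); apply: subset_leq_card; apply/subsetP=> w Hw.
rewrite inE; apply: contraT; rewrite negb_or inE => /andP[nw cw].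
case/negP: nw; apply/eqP; apply: (orbit_semiregular psi_skew X_orbit Hw Xk).
apply: ker_orbit; first by rewrite (generating_orbit_invariant X_orbit).
apply: (consecutive_involutions psi_skew X_orbit).
- by rewrite (generating_orbit_invariant X_orbit).
- exact: invol.
by rewrite -(cycle_permC _ Hw Hpsi); apply: invol.
Qed.

Let outside_card (Y : {set gT}) m : ~: (1 |: X) \subset Y -> (#|Y| <= m)%N ->
  (#|C|.*2 <= #|X| + m.+1)%N.
Proof.
move=> /subset_leq_card; rewrite cardsCs setCK cardsU1 X_not1 card_gT.
by set n := #|C|; set r := #|X|; set p := #|Y|; lia.
Qed.

Let psi_cycle_neq1 : psi \in <[psi]> /\ psi != 1.
Proof. by split=> //; apply: skew_perm_neq1. Qed.

Section OddCase.

Hypothesis I1 : I = [set 1].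

Let orbit_C c : c \in C -> c != 1 -> c \in X.
Proof.
move=> Cc nc; have: c \in X :&: C by rewrite orbitC I1 !inE nc.
by rewrite inE => /andP[].
Qed.

Let outside_refl y : y \notin X -> y != 1 -> y \notin C.
Proof. by move=> Xy ny; apply: contra Xy => /orbit_C->. Qed.

(** A nontrivial [s] fixes both reflections [y] and [psi y]; their product is a fixed rotation,
    hence lies in [I] and is trivial. *)
Let outside_fixed y : y \notin X -> y != 1 -> psi y = y.
Proof.
move=> Xy ny; have Cy := outside_refl Xy ny.
have [s [Hs ns] sy] := outside_fix Xy ny.
have spy := fix_set_invariant Hs Hpsi sy.
have Cpy : psi y \notin C.
  apply/negP=> /(fix_set_C Hs ns spy); rewrite I1 => /set1P/psi_eq1 y1.
  by rewrite y1 eqxx in ny.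
have := fix_set_mul Hs ns sy spy Cy Cpy; rewrite I1 => /setIP[_ /set1P].
exact: refl_mul1.
Qed.

Let outside_unique y u : y \notin X -> y != 1 -> u \notin X -> u != 1 -> y = u.
Proof.
move=> Xy ny Xu nu; have [_ npsi] := psi_cycle_neq1.
have fix_psi v : v \notin X -> v != 1 -> v \in fix_set psi.
  by move=> Xv nv; rewrite inE outside_fixed.
have Cy := outside_refl Xy ny; have Cu := outside_refl Xu nu.
have /setIP[_] := fix_set_mul Hpsi npsi (fix_psi y Xy ny) (fix_psi u Xu nu) Cy Cu.
by rewrite I1 => /set1P/(refl_mul1 Cy).
Qed.

Let X_ge : (#|C|.*2 <= #|X| + 2)%N.
Proof.
apply: (@outside_card (~: (1 |: X))) => //; apply/card_le1_eqP=> y u.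
by rewrite !inE !negb_or => /andP[ny Xy] /andP[nu Xu]; apply: outside_unique.
Qed.

Let cardI : #|I| = 1%N. Proof. by rewrite I1 cards1. Qed.

(** Otherwise [psi] fixes [k], and rotations and reflections alternate along [X]; the positions of
    [c] and [k * c] then contradict parity. *)
Let k_in_X : k \in X.
Proof.
apply: contraT => Xk.
have psik : psi k = k by apply: outside_fixed.
have R_C x : x \in X :\: C -> psi x \in X :&: C.
  rewrite !inE => /andP[Cx Xx]; rewrite (generating_orbit_invariant X_orbit) //=.
  apply: contraR Xk => Cpx; rewrite -(ker_orbit Xx) //.
  by apply: (consecutive_involutions psi_skew X_orbit) => //; apply: (refl_sqr dihC).
(* By [X_ge], [X] has at least as many reflections as rotations, so this injection is onto. *)
have imR : psi @: (X :\: C) = X :&: C.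
  apply/eqP; rewrite eqEcard; apply/andP; split.
    by apply/subsetP=> _ /imsetP[x Rx ->]; apply: R_C.
  rewrite (card_imset _ (@perm_inj _ psi)).
  have:= X_ge; have:= cardsID C X; have:= card_X.
  rewrite cardI; set n := #|C|; set r := #|X|.
  by set p := #|_ :\: _|; set q := #|_ :&: _|; lia.
have C_R c : c \in X :&: C -> psi c \in X :\: C.
  move=> XCc; have Xc : c \in X by case/setIP: XCc.
  rewrite inE (generating_orbit_invariant X_orbit) // andbT; apply/negP=> Cpc.
  have: psi c \in psi @: (X :\: C).
    by rewrite imR inE Cpc (generating_orbit_invariant X_orbit).
  rewrite (mem_imset _ _ (@perm_inj _ psi)) inE.
  by case/setIP: XCc => _ ->.
have evenC i c : c \in X :&: C -> (psi ^+ i.*2) c \in X :&: C.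
  move=> XCc; elim: i => [|i IHi]; first by rewrite perm1.
  by rewrite doubleS !expgSr !permM; apply/R_C/C_R.
have [c Cc nc] : exists2 c, c \in C & c != 1.
  by apply/trivgPn; rewrite trivg_card1; move: C_gt1; set n := #|C|; lia.
have Xc : c \in X by apply: orbit_C.
have Xkc : k * c \in X.
  apply: contraT => Xkc; have nkc : k * c != 1.
    by apply: contraNneq Ck => kc1; rewrite -(groupMr _ Cc) kc1 group1.
  move/eqP: (outside_unique Xkc nkc Xk k_neq1).
  by rewrite -{2}[k]mulg1 (inj_eq (mulgI k)) (negPf nc).
have [_ /cycleP[i ->] def_kc] := generating_orbitE X_orbit Xc Xkc.
have odd_i : odd i.
  apply: contraT => even_i; have := evenC i./2 c.
  rewrite even_halfK // inE Xc Cc -def_kc => /(_ isT).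
  by rewrite inE groupMr // (negPf Ck) andbF.
have kC j x : (psi ^+ j) (k * x) = k * (psi ^+ j) x.
  elim: j => [|j IHj]; first by rewrite !perm1.
  by rewrite expgSr !permM IHj ker_kM psik.
(* [psi ^+ i] sends [c] to [k * c] and commutes with left multiplication by [k], so its square fixes
   [c]. *)
have: psi ^+ i * psi ^+ i = 1.
  apply: (orbit_semiregular psi_skew X_orbit _ Xc); first by rewrite groupM ?mem_cycle.
  by rewrite permM -def_kc kC -def_kc mulgA kk mul1g.
move/eqP; rewrite -expgD -order_dvdn -card_orbit_order.
have le_R : (#|X :\: C| <= #|X :&: C|)%N.
  by rewrite -imR (card_imset _ (@perm_inj _ psi)).
have Er : #|X| = #|C|.-1.*2.
  have:= card_X; rewrite cardI; exact: (double_card_arith (cardsID C X) le_R X_ge C_gt1).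
(* As [2 (#|C| - 1)] divides [2 i], the even number [#|C| - 1] divides the odd [i]. *)
rewrite Er addnn => /dvdnP[m]; rewrite -doubleMr => /double_inj Ei.
move: odd_i; rewrite Ei oddM -subn1 oddB ?(ltnW C_gt1) //.
by rewrite (odd_invol_set I1) andbF.
Qed.

Lemma odd_two_element_kernel :
  [/\ #|C| = 3, #|X| = 4, k \in X, psi k \notin C & C :\ 1 \subset X].
Proof.
have X_n1 := orbit_at_k k_in_X.
have C3 : #|C| = 3.
  have:= odd_invol_set I1; have:= X_ge; rewrite X_n1; move: C_gt1.
  set n := #|C|; lia.
split=> //; first by rewrite X_n1 C3.
  have [] // := @orbit_invol_conj (psi k).
    by rewrite (generating_orbit_invariant X_orbit).
  by rewrite -ker_kM kk.
by apply/subsetP=> c; rewrite !inE => /andP[nc Cc]; apply: orbit_C.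
Qed.

End OddCase.

Section EvenCase.

Variable z : gT.
Hypothesis z_neq1 : z != 1.
Hypothesis Iz : I = [set 1; z].

Let zC : z \in C /\ z * z = 1.
Proof. by apply/invol_setP; rewrite -/I Iz !inE eqxx orbT. Qed.

Let cardI : #|I| = 2. Proof. by rewrite Iz cards2 eq_sym z_neq1. Qed.

Let Xz : z \notin X.
Proof.
apply/negP=> Xz; have: z \in X :&: C by rewrite inE Xz; case: zC.
by rewrite orbitC Iz !inE eqxx orbT.
Qed.

(** If [psi] fixed the central [z], so would every cofactor, and
    [psi (z * h) = psi (h * z) = psi h * z] would put the rotation [z] in the kernel. *)
Let psi_z : psi z != z.
Proof.
case: zC => Cz zz; apply/eqP=> psiz.
have fixz s : s \in <[psi]> -> s z = z.
  elim/cycle_perm_ind=> [|w _ IHw]; first by rewrite perm1.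
  by rewrite permM IHw.
have: z \in skew_ker psi.
  apply/skew_kerP=> // h; rewrite (central_involution dihC h Cz zz).
  by rewrite skew_cofK fixz // psiz (central_involution dihC _ Cz zz).
rewrite ker_k !inE (negPf z_neq1) /= => /eqP zk.
by move: Ck; rewrite -zk Cz.
Qed.

Let u := psi z.

Let fix_z s : s \in <[psi]> -> s != 1 -> z \in fix_set s ->
  u \in fix_set s /\ u \notin C.
Proof.
move=> Hs ns sz; have su := fix_set_invariant Hs Hpsi sz; split=> //.
apply/negP=> /(fix_set_C Hs ns su); rewrite Iz !inE (negPf psi_z) orbF.
by move/eqP/psi_eq1=> z1; move: z_neq1; rewrite z1 eqxx.
Qed.

(** Each element outside [1] and [X] is fixed by a nontrivial [s]; if [s] fixes [z] too, the element
    is one of the three set aside here. *)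
Let Y := ~: (1 |: X) :\: [set z; u; u * z].

Let outside_refl y : y \in Y -> [/\ y \notin X, y != 1 & y \notin C].
Proof.
rewrite !inE !negb_or => /andP[/andP[/andP[yz _] _] /andP[ny Xy]]; split=> //.
apply/negP=> Cy; case/negP: Xy.
have: y \in X :&: C by rewrite orbitC Iz !inE negb_or ny yz.
by rewrite inE => /andP[].
Qed.

Let outside_fixed y : y \in Y -> psi y = y.
Proof.
move=> Yy; have [Xy ny Cy] := outside_refl Yy; case: zC => Cz zz.
have [s [Hs ns] sy] := outside_fix Xy ny.
have sz : z \notin fix_set s.
  apply/negP=> /(fix_z Hs ns)[su Cu].
  have /setIP[_] := fix_set_mul Hs ns sy su Cy Cu.
  move: Yy; rewrite Iz !inE !negb_or => /andP[/andP[/andP[_ yu] yuz] _].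
  case/orP=> /eqP; first by move/(refl_mul1 Cy)=> uy; rewrite uy eqxx in yu.
  move=> def_z; case/eqP: yuz; rewrite -(central_involution dihC _ Cz zz) -def_z.
  by rewrite -mulgA (refl_sqr dihC Cu) mulg1.
have spy := fix_set_invariant Hs Hpsi sy.
have Cpy : psi y \notin C.
  apply/negP=> /(fix_set_C Hs ns spy); rewrite Iz => /set2P[/psi_eq1 y1|pyz].
    by rewrite y1 eqxx in ny.
  by rewrite pyz (negPf sz) in spy.
have /setIP[syy] := fix_set_mul Hs ns sy spy Cy Cpy.
rewrite Iz => /set2P[|yyz]; first exact: refl_mul1.
by rewrite yyz (negPf sz) in syy.
Qed.

Let outside_unique y v : y \in Y -> v \in Y -> y = v.
Proof.
move=> Yy Yv; have [_ npsi] := psi_cycle_neq1.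
have [_ _ Cy] := outside_refl Yy; have [_ _ Cv] := outside_refl Yv.
have fix_psi e : e \in Y -> e \in fix_set psi.
  by move=> Ye; rewrite inE outside_fixed.
have /setIP[fix_yv] := fix_set_mul Hpsi npsi (fix_psi y Yy) (fix_psi v Yv) Cy Cv.
rewrite Iz => /set2P[/(refl_mul1 Cy)//|yvz].
by rewrite yvz inE (negPf psi_z) in fix_yv.
Qed.

Let X_ge : (#|C|.*2 <= #|X| + 5)%N.
Proof.
apply: (@outside_card ([set z; u; u * z] :|: Y)).
  by apply/subsetP=> y Xy; rewrite !inE; move: Xy; rewrite !inE => ->; rewrite andbT orbN.
apply: leq_trans (leq_card_setU _ _) _.
have le1 : (#|Y| <= 1)%N by apply/card_le1_eqP=> y v Yy Yv; apply: outside_unique.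
have le3 : (#|[set z; u; (u * z)%g]| <= 3)%N.
  by rewrite setUC cardsU1 cards2; case: (_ \notin _); case: (_ != _).
exact: leq_add le3 le1.
Qed.

(** Each reflection [x] of [X] is conjugated to [k] by exactly two rotations, and such a rotation
    determines [x]. *)
Let card_refl : (#|X :\: C|.*2 <= #|C|)%N.
Proof.
have ->: #|X :\: C|.*2 = \sum_(x in X :\: C) #|A x|.
  rewrite -muln2 -sum_nat_const; apply: eq_bigr => x; rewrite inE => /andP[Cx Xx].
  by have [_ _ ->] := orbit_involution Xx (refl_sqr dihC Cx).
rewrite -[#|C|]sum1_card.
under eq_bigr do rewrite -sum1_card.
rewrite (exchange_big_dep (mem C)) /=; last by move=> x c _; rewrite inE => /andP[].
apply: leq_sum => c Cc; rewrite sum1dep_card; apply/card_le1_eqP=> x y.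
rewrite !inE Cc /= => /andP[_ /eqP cx] /andP[_ /eqP cy].
by apply: (mulgI c); rewrite cx.
Qed.

(** The counts give [psi] the prime order 7, so a nontrivial power of [psi] fixing [z] generates
    [<[psi]>], against [psi_z]. *)
Lemma even_two_element_kernel : False.
Proof.
have r7 : #[psi] = 7.
  rewrite -card_orbit_order; have:= card_X; rewrite cardI => /seven_card_arith.
  exact.
have [s [Hs ns] sz] := outside_fix Xz z_neq1.
have: <[s]> == <[psi]>.
  rewrite eqEcard cycle_subG Hs -!orderE r7 /=.
  have s7 : (#[s] %| 7)%N by rewrite -r7; apply: order_dvdG.
  have /primeP[_ /(_ _ s7)/pred2P[/eqP|-> //]] := isT : prime 7.
  by rewrite order_eq1 (negPf ns).
move/eqP=> eq_s; case/negP: psi_z; have := Hpsi; rewrite -eq_s => /cycleP[i ->].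
move: sz; rewrite inE => /eqP sz; apply/eqP.
by elim: i => [|i IHi]; rewrite ?perm1 // expgSr permM IHi.
Qed.

End EvenCase.

Lemma two_element_kernel :
  [/\ #|C| = 3, #|X| = 4, k \in X, psi k \notin C & C :\ 1 \subset X].
Proof.
have [I1|[z nz Iz]] := invol_setVmem dihC; first exact: odd_two_element_kernel.
by case: (even_two_element_kernel nz Iz).
Qed.

End TwoElementKernel.
End DihedralSkew.

(** * Kernels contained in the rotation subgroup *)

Section KernelInRotations.

Variables (gT : finGroupType) (C : {group gT}) (psi : {perm gT}) (X : {set gT}).
Implicit Types (g h k x y c u : gT) (s w : {perm gT}).
Hypothesis dihC : dihedral_over C.
Hypothesis C_gt1 : (1 < #|C|)%N.
Hypothesis psi_skew : skew_perm psi.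
Hypothesis X_orbit : generating_orbit psi X.
Hypothesis ker_C : skew_ker psi \subset C.

Let psi1 : psi 1 = 1. Proof. by case: psi_skew. Qed.
Let X_gen : <<X>> = [set: gT]. Proof. by case: X_orbit. Qed.
Let cycC : cyclic C. Proof. by case: dihC. Qed.
Let card_gT : #|gT| = #|C|.*2. Proof. by case: dihC. Qed.
Let Hpsi : psi \in <[psi]>. Proof. exact: cycle_id. Qed.
Let Hcof g : skew_cof psi g \in <[psi]>. Proof. exact: skew_cof_cycle. Qed.

Let N : {group gT} := Group (skew_ker_group_set psi1).

Let N_mul k : k \in N -> forall g, psi (k * g) = psi k * psi g.
Proof. by move=> Nk; apply/skew_kerP. Qed.

Let consecutive_refl x : x \in X -> x \notin C -> psi x \in C.
Proof.
move=> Xx Cx; apply: contraT => Cpx; case/negP: (Cx); apply: (subsetP ker_C).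
by apply: (consecutive_involutions psi_skew X_orbit) => //; apply: (refl_sqr dihC).
Qed.

(** Otherwise [a] is a central involution generating the kernel, so [#|X| > #|C|]. A nontrivial [s]
    fixes a subgroup of order at least [#|C|], whose complement is too small for [X]. *)
Lemma kernel_generator_rotation a : skew_ker psi = <[a]> -> psi a \in C.
Proof.
move=> ker_a; apply: contraT => Ct; set t := psi a in Ct.
have Na : a \in N by rewrite /= ker_a cycle_id.
have Ca : a \in C by apply: (subsetP ker_C).
have aa : a * a = 1.
  by apply: (@perm_inj _ psi); rewrite N_mul // psi1; apply: (refl_sqr dihC).
have na : a != 1 by apply: contraNneq Ct => a1; rewrite /t a1 psi1 group1.
have ca g : a * g = g * a := central_involution dihC g Ca aa.
have card_a : #|skew_ker psi| = 2 by rewrite ker_a -orderE; apply: nt_prime_order.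
have X_gtC : (#|C| < #|X|)%N.
  have := card_cof_set psi_skew; rewrite card_a card_gT muln2 => /double_inj <-.
  exact: card_cof_set_ltX dihC C_gt1 psi_skew X_orbit.
pose g := psi^-1 a; have psig : psi g = a by rewrite /g permKV.
have cof_a : skew_cof psi g a = t.
  apply: (mulgI a); rewrite -{1}psig -skew_cofK -ca N_mul // -/t psig.
  by rewrite ca.
have ng : skew_cof psi g != psi.
  apply/negP=> Ng; have: g \in N by rewrite /= inE.
  rewrite /= ker_a cycle2g ?inE; last exact: nt_prime_order.
  case/orP=> /eqP gE; first by rewrite -psig gE psi1 eqxx in na.
  by move: Ct; rewrite /t -[in psi a]gE psig Ca.
pose s := skew_cof psi g * psi^-1.
have Hs : s \in <[psi]> by rewrite groupM ?groupV.
have ns : s != 1 by rewrite -eq_mulgV1.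
have sa : a \in fix_set s by rewrite inE permM cof_a permK.
pose F := Group (fix_set_group_set psi_skew Hs).
have Ft : t \in F := fix_set_invariant Hs Hpsi sa.
(* The conjugate [c^-1 * t * c] is the image of [a] under a cofactor, hence lies in [F]; multiplied
   by [t] it gives [c * c]. *)
have Fsqr c : c \in C -> c * c \in F.
  move=> Cc; pose g' := psi^-1 c; have psig' : psi g' = c by rewrite /g' permKV.
  have: t * (c^-1 * t * c) \in F.
    have <-: skew_cof psi g' a = c^-1 * t * c.
      by rewrite skew_cofE -ca N_mul // psig' mulgA.
    by rewrite groupM //; apply: (fix_set_invariant Hs (Hcof _) sa).
  have ->: c^-1 * t = t * c by rewrite (refl_conj dihC) ?groupV // invgK.
  by rewrite !mulgA (refl_sqr dihC Ct) mul1g.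
have /cyclicP[e defC] := cycC.
have Ce : e \in C by rewrite defC cycle_id.
have le_C : (#|C| <= #|C :&: F| + #|C :&: F|)%N.
  rewrite -{2}(card_lcoset (C :&: F) e); apply: leq_trans (leq_card_setU _ _).
  apply: subset_leq_card; apply/subsetP=> c; rewrite {1}defC => /cycleP[i ->].
  have even_in j : e ^+ j.*2 \in C :&: F.
    by rewrite -addnn expgD inE Fsqr ?groupM ?groupX.
  rewrite inE mem_lcoset -(odd_double_half i); case: (odd i).
    by rewrite expgD expg1 mulKg even_in orbT.
  by rewrite add0n even_in.
have dis : (C :&: F) :&: t *: (C :&: F) = set0.
  apply/setP=> c; rewrite !inE mem_lcoset !inE; apply/negP.
  case/andP=> /andP[Cc _] /andP[+ _].
  by rewrite groupMr // groupV (negPf Ct).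
have le_F : (#|C :&: F| + #|C :&: F| <= #|F|)%N.
  rewrite -{2}(card_lcoset (C :&: F) t) -[X in (X <= _)%N]subn0 -(cards0 gT).
  rewrite -dis -cardsU; apply: subset_leq_card; rewrite subUset subsetIr.
  by apply/subsetP=> c; rewrite mem_lcoset => /setIP[_]; rewrite (groupMl _ (groupVr Ft)).
have: (#|F| + #|X| <= #|gT|)%N.
  rewrite -cardsT -(cardsID F [set: gT]) setTI leq_add2l setTD.
  apply: subset_leq_card; apply/subsetP=> x Xx; rewrite inE.
  exact: (fix_setX psi_skew X_orbit Hs ns Xx).
rewrite card_gT -addnn leqNgt -addnS leq_add ?(leq_trans le_C) //.
Qed.

(** [psi] is multiplicative on the kernel [<[a]>], so [psi a] has the order of [a], and the cyclic
    [C] has one subgroup of that order. *)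
Lemma kernel_invariant k s :
  s \in <[psi]> -> k \in skew_ker psi -> s k \in skew_ker psi.
Proof.
rewrite -[skew_ker psi]/(gval N).
have /cyclicP[a ker_a] : cyclic N by apply: cyclicS cycC.
have Cpa : psi a \in C by apply: kernel_generator_rotation.
have Na : a \in N by rewrite ker_a cycle_id.
have psiX i : psi (a ^+ i) = psi a ^+ i.
  by elim: i => [|i IHi]; rewrite ?expg0 // !expgS N_mul // IHi.
have eq_a : <[psi a]> = <[a]>.
  apply/eqP; rewrite (eq_subG_cyclic cycC) ?cycle_subG //; last first.
    exact: (subsetP ker_C).
  rewrite -!orderE eqn_dvd !order_dvdn -psiX expg_order psi1 eqxx /=.
  by apply/eqP/(@perm_inj _ psi); rewrite psiX expg_order psi1.
move=> Hs; elim/cycle_perm_ind: s / Hs k => [|w _ IHw] k Nk; first by rewrite perm1.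
rewrite permM; move: (IHw _ Nk); rewrite ker_a => /cycleP[i ->].
by rewrite psiX -eq_a mem_cycle.
Qed.

Let N_morph k s : s \in <[psi]> -> k \in N -> forall g, s (k * g) = s k * s g.
Proof.
elim/cycle_perm_ind=> [|w Hw IHw] Nk g; first by rewrite !perm1.
by rewrite !permM IHw // N_mul // kernel_invariant.
Qed.

Lemma kernel_proper : skew_ker psi \proper C.
Proof.
rewrite properEneq ker_C andbT; apply/eqP=> defC.
have [x Xx Cx] := orbit_reflection dihC C_gt1 X_orbit.
case/negP: (Cx); rewrite -defC -(permK psi x); apply: kernel_invariant.
  by rewrite groupV.
by rewrite defC; apply: consecutive_refl.
Qed.

Lemma kernel_norm : [set: gT] \subset 'N(skew_ker psi).
Proof.
rewrite -[skew_ker psi]/(gval N).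
apply/subsetP=> g _; have [Cg|Cg] := boolP (g \in C).
  apply: (subsetP _ g Cg); apply: sub_abelian_norm => //.
  exact: cyclic_abelian.
rewrite inE; apply/subsetP=> _ /imsetP[k Nk ->]; rewrite conjgE (refl_inv dihC Cg).
by rewrite (refl_conj dihC Cg (subsetP ker_C k Nk)) mulgA (refl_sqr dihC Cg) mul1g groupV.
Qed.

(* An element of <[psi]> that fixes every coset of the kernel sends a
   reflection of X to a reflection, so it is multiplicative at that reflection;
   conjugating by psi spreads this over X. *)
Lemma kernel_coset_morphism s : s \in <[psi]> ->
  (forall g, s g * g^-1 \in skew_ker psi) -> forall g h, s (g * h) = s g * s h.
Proof.
move=> Hs coset_s; have s1 := skew_perm1 psi_skew Hs.
have [x Xx Cx] := orbit_reflection dihC C_gt1 X_orbit.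
have Csx : s x \notin C.
  by rewrite -[s x](mulgKV x) groupMl // (subsetP ker_C).
have cof_x : skew_cof s x = s.
  apply: (generating_orbit_inj psi_skew X_orbit _ Hs Xx).
    exact: skew_cof_cycle.
  by rewrite skew_cofE (refl_sqr dihC Cx) s1 mulg1 (refl_inv dihC Csx).
have cof_N w k g : w \in <[psi]> -> k \in N -> skew_cof w (k * g) = skew_cof w g.
  move=> Hw Nk; apply/permP=> u; rewrite !skew_cofE -mulgA !(N_morph Hw Nk).
  by rewrite invMg -mulgA mulKg.
have: <<X>> \subset Group (skew_ker_group_set s1).
  rewrite gen_subG; apply/subsetP=> y Xy; rewrite inE.
  have [v Hv def_y] := generating_orbitE X_orbit Xx Xy; rewrite def_y.
  apply/eqP; apply: (mulgI (skew_cof v x)); rewrite -skew_cofM.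
  rewrite (cycle_comm Hv Hs) skew_cofM cof_x -[s x](mulgKV x) cof_N //.
  by rewrite (cycle_comm Hs) // skew_cof_cycle.
rewrite X_gen => /subsetP kerT g h; move: (kerT g (in_setT g)) => /=.
by move=> /(skew_kerP _ s1).
Qed.

(** Expanding [psi (g * (g * u))] gives [psi u = psi g * s (psi g) * s (s (psi u))]; the case
    [u = 1] removes the prefactor. *)
Lemma kernel_coset_involution g s : g \notin C -> s \in <[psi]> ->
  skew_cof psi g = psi * s -> (forall h, s h * h^-1 \in skew_ker psi) -> s * s = 1.
Proof.
move=> Cg Hs cof_g coset_s; have morph := kernel_coset_morphism Hs coset_s.
have E u : psi u = psi g * s (psi g) * s (s (psi u)).
  rewrite -{1}[u](mulKg g) (refl_inv dihC Cg) skew_cofK cof_g permM.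
  by rewrite skew_cofK cof_g permM morph mulgA.
apply/permP=> u; rewrite permM perm1; have := E (psi^-1 u); rewrite permKV.
have:= E 1; rewrite psi1 !(skew_perm1 psi_skew Hs) mulg1 => <-.
by rewrite mul1g.
Qed.

End KernelInRotations.

(** * Quotients by an invariant normal subgroup *)

Section Quotient.

Variables (gT : finGroupType) (N : {group gT}) (psi : {perm gT}).
Implicit Types (g h x : gT) (s : {perm gT}).
Hypothesis norm_N : [set: gT] \subset 'N(N).
Hypothesis psi_skew : skew_perm psi.
Hypothesis N_inv : forall k s, s \in <[psi]> -> k \in N -> s k \in N.

Let inN g : g \in 'N(N). Proof. exact: (subsetP norm_N). Qed.

Lemma coset_surj (xb : coset_of N) : exists g, xb = coset N g.
Proof. by exists (repr xb); rewrite coset_reprK. Qed.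

Let cosetM g h : coset N (g * h) = coset N g * coset N h.
Proof. exact: coset_morphM. Qed.

Let cosetV g : coset N g^-1 = (coset N g)^-1.
Proof. exact: (morphV (coset_morphism N)). Qed.

Definition quotient_fun s (xb : coset_of N) := coset N (s (repr xb)).

(** Independence of the representative: [s (g * m) = s g * skew_cof s g m], and the cofactor
    preserves [N]. *)
Lemma quotient_funE s g : s \in <[psi]> ->
  quotient_fun s (coset N g) = coset N (s g).
Proof.
move=> Hs; rewrite /quotient_fun.
have: coset N (repr (coset N g)) = coset N g by rewrite coset_reprK.
case/kercoset_rcoset=> // k Nk ->.
have: k * g \in g *: N by rewrite -norm_rlcoset // mem_rcoset mulgK.
case/lcosetP=> m Nm ->; rewrite skew_cofK coset_kerr //.
by apply: N_inv => //; apply: (skew_cof_cycle psi_skew).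
Qed.

Lemma quotient_fun_inj : injective (quotient_fun psi).
Proof.
apply: (can_inj (g := quotient_fun psi^-1)) => xb; have [g ->] := coset_surj xb.
by rewrite !quotient_funE ?groupV ?cycle_id // permK.
Qed.

Definition quotient_perm : {perm coset_of N} := perm quotient_fun_inj.

Lemma quotient_permE g : quotient_perm (coset N g) = coset N (psi g).
Proof. by rewrite permE quotient_funE // cycle_id. Qed.

Lemma quotient_permX i g :
  (quotient_perm ^+ i) (coset N g) = coset N ((psi ^+ i) g).
Proof.
elim: i => [|i IHi]; first by rewrite !perm1.
by rewrite !expgSr !permM IHi quotient_permE.
Qed.

Lemma quotient_skew_cofE g h :
  skew_cof quotient_perm (coset N g) (coset N h) = coset N (skew_cof psi g h).
Proof.
by rewrite !skew_cofE -cosetM !quotient_permE -cosetV -cosetM.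
Qed.

Lemma quotient_skew_perm : skew_perm quotient_perm.
Proof.
case: (psi_skew) => psi1 cof_psi; split.
  by rewrite -(coset_id (group1 N)) quotient_permE psi1.
move=> gb; have [g ->] := coset_surj gb; have /cycleP[i Ei] := cof_psi g.
apply/cycleP; exists i; apply/permP=> hb; have [h ->] := coset_surj hb.
by rewrite quotient_skew_cofE quotient_permX Ei.
Qed.

Lemma quotient_generating_orbit X : generating_orbit psi X -> [disjoint X & N] ->
  generating_orbit quotient_perm (X / N).
Proof.
move=> [X_gen _ porbitX] dis; split.
- by rewrite -quotient_gen ?X_gen ?quotientT // (subset_trans (subsetT _)).
- apply/negP=> /morphimP[x Nx Xx /esym/(coset_idr Nx) kx].
  by rewrite (disjointFr dis Xx) in kx.
move=> _ /morphimP[x Nx Xx ->] /=; apply/setP=> yb; apply/porbitP/morphimP.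
  case=> i ->; rewrite quotient_permX; exists ((psi ^+ i) x) => //.
  by rewrite -(porbitX x Xx) mem_porbit.
case=> y _; rewrite -(porbitX x Xx) => /porbitP[i ->] ->.
by exists i; rewrite quotient_permX.
Qed.

Lemma mem_quotient_sub (C : {group gT}) g :
  N \subset C -> (coset N g \in C / N) = (g \in C).
Proof.
move=> sNC; apply/idP/idP=> [|Cg]; last exact: mem_quotient.
case/morphimP=> c Nc Cc /kercoset_rcoset[] // k Nk ->.
by rewrite groupM // (subsetP sNC).
Qed.

Lemma card_coset_of : #|{: coset_of N}| = #|[set: gT] : N|.
Proof. by rewrite -card_quotient // quotientT cardsT. Qed.

Lemma quotient_dihedral_over (C : {group gT}) :
  N \subset C -> dihedral_over C -> dihedral_over (C / N).
Proof.
move=> sNC dihC; have [cycC cardC _] := dihC; split.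
- exact: quotient_cyclic.
- apply: etrans card_coset_of _.
  rewrite (card_quotient (subset_trans (subsetT C) norm_N)).
  apply/eqP; rewrite -(eqn_pmul2l (cardG_gt0 N)) -doubleMr (Lagrange sNC).
  by rewrite (Lagrange (subsetT N)) cardsT cardC.
move=> xb; have [g ->] := coset_surj xb; rewrite mem_quotient_sub // => Cg.
by rewrite -cosetM (refl_sqr dihC Cg) coset_id.
Qed.

End Quotient.

(** * The kernel theorem by induction on the group order *)

Theorem skew_dihedral_kernel (gT : finGroupType) (C : {group gT}) psi X :
  dihedral_over C -> (1 < #|C|)%N -> skew_perm psi -> generating_orbit psi X ->
  (exists2 g, g \in skew_ker psi & g \notin C) /\
  ((4 <= #|skew_ker psi|)%N \/
   (#|skew_ker psi| = 2 /\ exists k, [/\ k \notin C, skew_ker psi = [set 1; k],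
     [/\ #|C| = 3, #|X| = 4 & C :\ 1 \subset X], k \in X & psi k \notin C])).
Proof.
have [m] := ubnP #|gT|; elim: m gT C psi X => // m IHm gT C psi X lt_m.
move=> dihC C_gt1 psi_skew X_orbit; have [psi1 _] := psi_skew.
pose K := Group (skew_ker_group_set psi1).
have [g Kg Cg] : exists2 g, g \in skew_ker psi & g \notin C.
  apply/exists_inP; apply: contraT; rewrite negb_exists_in => /forall_inP kerC.
  have {kerC} ker_C : skew_ker psi \subset C.
    by apply/subsetP=> g /kerC; rewrite negbK.
  have norm_K : [set: gT] \subset 'N(K) := kernel_norm dihC psi_skew ker_C.
  have inv_K k s : s \in <[psi]> -> k \in K -> s k \in K.
    by move=> Hs Kk; apply: (kernel_invariant dihC C_gt1 psi_skew X_orbit ker_C Hs).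
  have prop_K : K \proper C.
    exact: (kernel_proper dihC C_gt1 psi_skew X_orbit ker_C).
  pose psib := quotient_perm norm_K psi_skew inv_K.
  have skewb : skew_perm psib := quotient_skew_perm norm_K psi_skew inv_K.
  have consec x : x \in X -> x \notin C -> psi x \notin C -> false.
    move=> Xx Cx Cpx; case/negP: (Cx); apply: (subsetP ker_C).
    by apply: (consecutive_involutions psi_skew X_orbit) => //; apply: (refl_sqr dihC).
  have dis : [disjoint X & K].
    rewrite -setI_eq0; apply/eqP/setP=> x; rewrite in_setI in_set0.
    apply/negP=> /andP[Xx Kx].
    have [y Xy Cy] := orbit_reflection dihC C_gt1 X_orbit.
    have [s Hs ys] := generating_orbitE X_orbit Xx Xy.
    by case/negP: Cy; apply: (subsetP ker_C); rewrite ys (inv_K x s).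
  have memC g : (coset K g \in C / K) = (g \in C).
    exact: (mem_quotient_sub norm_K g (proper_sub prop_K)).
  have cof_inv g : g \notin C -> coset K g \in skew_ker psib ->
      exists2 s, s \in <[psi]> & [/\ skew_cof psi g = psi * s, s * s = 1 & s != 1].
    move=> Cg; rewrite inE => /eqP cofb; pose s := psi^-1 * skew_cof psi g.
    have Hs : s \in <[psi]> by rewrite groupM ?groupV ?cycle_id // skew_cof_cycle ?cycle_id.
    have def_s : skew_cof psi g = psi * s by rewrite mulKVg.
    exists s => //; split=> //.
      apply: (kernel_coset_involution dihC C_gt1 psi_skew X_orbit ker_C Cg Hs def_s).
      move=> h; have:= quotient_skew_cofE norm_K psi_skew inv_K g (psi^-1 h).
      rewrite -/psib cofb quotient_permE permKV def_s permM permKV => eq_h.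
      have [||k Kk ->] := kercoset_rcoset _ _ (esym eq_h).
      - exact: (subsetP norm_K).
      - exact: (subsetP norm_K).
      by rewrite mulgK.
    apply: contraNneq Cg => s1; apply: (subsetP ker_C); rewrite inE.
    by rewrite def_s s1 mulg1.
  have dihb := quotient_dihedral_over norm_K (proper_sub prop_K) dihC.
  have orbb := quotient_generating_orbit norm_K psi_skew inv_K X_orbit dis.
  (* The number of cofactors is below [#|X|], hence below the group order; so the quotient is
     strictly smaller. *)
  have K_gt1 : (1 < #|K|)%N.
    have: (#|cof_set psi| < #|cof_set psi| * #|K|)%N.
      rewrite card_cof_set //; apply: leq_trans (max_card (mem X)).
      exact: (card_cof_set_ltX dihC C_gt1 psi_skew X_orbit).
    by case: #|K| => [|[|]] //; rewrite ?muln0 ?muln1 ?ltnn.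
  have [||[gb Kgb Cgb] card_b] := IHm _ (C / K)%G psib (X / K) _ dihb _ skewb orbb.
  - rewrite -ltnS (card_coset_of norm_K); apply: leq_trans lt_m.
    rewrite ltnS -[#|gT|]cardsT -(Lagrange (subsetT K)) ltn_Pmull //.
  - rewrite (card_quotient (subset_trans (subsetT C) norm_K)) indexg_gt1.
    by have [] := andP prop_K.
  (* In the exceptional case the reflections [kb] and [psib kb] lift to consecutive reflections of
     [X], which [consec] forbids. *)
  case: card_b => [|[_ [kb [Ckb _ _ Xkb Cpkb]]]]; last first.
    case/morphimP: Xkb => x _ Xx /= def_kb; apply: (consec x) => //.
      by rewrite -memC -def_kb.
    by move: Cpkb; rewrite def_kb quotient_permE memC.
  rewrite leqNgt => /negP[]; rewrite ltnS; apply: (@leq_trans 2) => //.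
  (* Two such reflections lift to elements whose cofactors are both [psi] times the unique
     involution of [<[psi]>], so the lifts share a coset of [K]. *)
  have uniq_b xb yb : xb \in skew_ker psib -> xb \notin C / K ->
      yb \in skew_ker psib -> yb \notin C / K -> xb = yb.
    have [x ->] := coset_surj xb; have [y ->] := coset_surj yb.
    rewrite !memC => Kx Cx Ky Cy.
    have [s Hs [cof_x ss ns]] := cof_inv x Cx Kx.
    have [w Hw [cof_y ww nw]] := cof_inv y Cy Ky.
    have: skew_cof psi x == skew_cof psi y.
      by rewrite cof_x cof_y (cyclic_involution_unique (cycle_cyclic psi) Hs Hw).
    rewrite skew_cof_eq // => Kxy; rewrite -[x](mulgKV y).
    have Nxy g : g \in 'N(K) by apply: (subsetP norm_K).
    by rewrite coset_morphM // coset_id // mul1g.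
  have [psib1 _] := skewb; pose Kb := Group (skew_ker_group_set psib1).
  have: skew_ker psib \subset [set 1; gb].
    apply/subsetP=> xb Kxb; rewrite !inE.
    have [Cxb|Cxb] := boolP (xb \in C / K); last by rewrite (uniq_b xb gb) // eqxx orbT.
    (* A rotation of the kernel times [gb] is again a reflection of the kernel. *)
    have: xb * gb = gb by apply: uniq_b; rewrite ?groupMl // (@groupM _ Kb).
    by rewrite -{2}[gb]mul1g => /mulIg->; rewrite eqxx.
  by move/subset_leq_card/leq_trans; apply; rewrite cards2; case: (_ != _).
split; first by exists g.
have even_K : (2 %| #|K|)%N.
  have <-: #[g] = 2.
    apply: nt_prime_order => //; first exact: (refl_sqr dihC).
    by apply: contraNneq Cg => ->; apply: group1.
  exact: order_dvdG.
have [|lt4] := leqP 4 #|skew_ker psi|; first by left.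
right; have card2 : #|skew_ker psi| = 2.
  have: (0 < #|K|)%N := cardG_gt0 K.
  by move: even_K lt4 => /=; case: #|_| => [|[|[|[|]]]].
have ker_g : skew_ker psi = [set 1; g].
  apply/esym/eqP; rewrite eqEcard card2 cards2.
  have ->: 1 != g by apply: contraNneq Cg => <-; apply: group1.
  by rewrite andbT; apply/subsetP=> x /set2P[]-> //; apply: (@group1 _ K).
split=> //; exists g.
by have [] := two_element_kernel dihC C_gt1 psi_skew X_orbit Cg ker_g.
Qed.

(** * From the presentation to the dihedral structure *)

Lemma dihedral_presentation_over (gT : finGroupType) n (a b : gT) :
  (1 < n)%N -> dihedral_presentation n a b ->
  dihedral_over <[a]>%G /\ #|<[a]>| = n.
Proof.
move=> n_gt1 [an b2 baba gen_ab isoD].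
(* ['D_(n.*2)], known through the relation [x ^ y = x^-1], satisfies the present relations and so is
   an image of the group. *)
have le_card : (n.*2 <= #|gT|)%N.
  have homD : [set: 'D_(n.*2)] \homg Grp (x : y : x ^+ n, y ^+ 2, y * x * y * x).
    have /existsP[[x y] /= /eqP[gen xn y2 xy]] := isoGrp_hom (Grp_dihedral n_gt1).
    apply/existsP; exists (x, y); rewrite /= !xpair_eqE gen xn y2 !eqxx /=.
    have yV : y^-1 = y by apply/eqP; rewrite eq_invg_mul -expg2 y2.
    by move: xy; rewrite conjgE yV mulgA => ->; rewrite mulVg.
  rewrite -isoD in homD; have := card_homg homD; rewrite card_dihedral // cardsT.
  by apply: dvdn_leq; rewrite -cardsT cardG_gt0.
have bV : b^-1 = b by apply/eqP; rewrite eq_invg_mul -expg2 b2.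
have ab : a ^ b = a^-1.
  by apply: (mulIg a); rewrite mulVg conjgE bV mulgA.
have defG : [set: gT] = <[a]> * <[b]>.
  rewrite -norm_joinEr; first by rewrite joing_idl joing_idr -gen_ab.
  by rewrite cycle_subG inE -cycleJ ab cycle_subG groupV cycle_id.
have oa : (#[a] <= n)%N by rewrite dvdn_leq ?order_dvdn ?an // (ltnW n_gt1).
have ob : (#[b] <= 2)%N by rewrite dvdn_leq // order_dvdn b2.
have: (#|gT| <= #[a] * #[b])%N.
  rewrite -[#|gT|]cardsT defG !orderE mul_cardG leq_pmulr //.
move=> le_gT; have ob2 : #[b] = 2.
  apply/eqP; rewrite eqn_leq ob /= ltnNge; apply/negP=> ob1.
  have := leq_trans le_card (leq_trans le_gT (leq_mul oa ob1)).
  by rewrite muln1 -addnn -{3}[n]addn0 leq_add2l leqNgt (ltnW n_gt1).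
have oan : #[a] = n.
  apply/eqP; rewrite eqn_leq oa /= -leq_double -!muln2 -{2}ob2 muln2.
  exact: leq_trans le_card le_gT.
split; last by rewrite -orderE.
split; first exact: cycle_cyclic.
  rewrite -orderE oan; apply/eqP; rewrite eqn_leq le_card andbT.
  by rewrite -muln2 -oan -ob2.
move=> x; have: x \in [set: gT] by rewrite inE.
rewrite defG => /mulsgP[_ y /cycleP[i ->] + ->].
rewrite cycle2g // => /set2P[]->; first by rewrite mulg1 mem_cycle.
move=> _; have abi : b * a ^+ i * b = a ^- i.
  by rewrite -expVgn -ab -conjXg conjgE bV mulgA.
by rewrite -mulgA [b * _]mulgA abi mulgV.
Qed.

(** * Counting orbits of uniform length *)

Section PorbitCount.

Variables (T : finType) (s : {perm T}).

Lemma card_porbit_min m x : (0 < m)%N -> (s ^+ m) x = x ->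
  (forall j, (0 < j < m)%N -> (s ^+ j) x != x) -> #|porbit s x| = m.
Proof.
move=> m_gt0 smx s_neq; apply/eqP; rewrite eqn_leq; apply/andP; split.
  have sX j : (s ^+ (j * m)) x = x.
    by elim: j => [|j IHj]; rewrite ?mul0n ?perm1 // mulSn expgD permM smx.
  rewrite -[m in leqRHS]card_ord -cardsT.
  apply: leq_trans (leq_imset_card (fun j : 'I_m => (s ^+ j) x) _).
  apply: subset_leq_card; apply/subsetP=> _ /porbitP[i ->].
  apply/imsetP; exists (Ordinal (ltn_pmod i m_gt0)) => //=.
  by rewrite {1}(divn_eq i m) expgD permM sX.
rewrite leqNgt; apply/negP=> lt_m.
have q_lt : (0 < #|porbit s x| < m)%N.
  by rewrite lt_m andbT; apply/card_gt0P; exists x; apply: porbit_id.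
by case/eqP: (s_neq _ q_lt); rewrite permX iter_porbit.
Qed.

Lemma card_porbits_uniform m :
  (forall x, #|porbit s x| = m) -> (#|porbits s| * m = #|T|)%N.
Proof.
move=> unif; rewrite -[RHS]sum1_card (partition_big_imset (porbit s)) /=.
rewrite -sum_nat_const; apply: eq_bigr => _ /imsetP[x _ ->].
rewrite sum1dep_card -(unif x); apply: eq_card => y.
by rewrite inE eq_porbit_mem.
Qed.

End PorbitCount.

(** * Recognition of the octahedron *)

Section Octahedron.

Variables (gT : finGroupType) (C : {group gT}) (M : cayley_map gT).
Variables (psi : {perm gT}) (k : gT).
Implicit Types (d : cm_dart M) (x g h c : gT).
Let X := cm_set M.
Hypothesis dihC : dihedral_over C.
Hypothesis psi_skew : skew_perm psi.
Hypothesis X_orbit : generating_orbit psi X.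
Hypothesis psi_p : {in X, psi =1 cm_perm M}.
Hypothesis Ck : k \notin C.
Hypothesis ker_k : k \in skew_ker psi.
Hypothesis C3 : #|C| = 3.
Hypothesis X4 : #|X| = 4.
Hypothesis CX : C :\ 1 \subset X.
Hypothesis Xk : k \in X.
Hypothesis Ct : psi k \notin C.

Let psi1 : psi 1 = 1. Proof. by case: psi_skew. Qed.
Let Hpsi : psi \in <[psi]>. Proof. exact: cycle_id. Qed.
Let X_not1 : 1 \notin X. Proof. by case: X_orbit. Qed.
Let X_psi x : x \in X -> psi x \in X.
Proof. exact: (generating_orbit_invariant X_orbit Hpsi). Qed.
Let card_gT : #|gT| = 6. Proof. by case: dihC => _ -> _; rewrite C3. Qed.

Let o_psi : #[psi] = 4.
Proof.
rewrite -(card_generating_orbit psi_skew X_orbit) //.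
by rewrite trivg_card1 cardsT card_gT.
Qed.

Let psi_free x j : x \in X -> (0 < j < 4)%N -> (psi ^+ j) x != x.
Proof.
move=> Xx /andP[j0 j4]; apply/eqP.
move/(orbit_semiregular psi_skew X_orbit (mem_cycle psi j) Xx)/eqP.
by rewrite -order_dvdn o_psi => /(dvdn_leq j0); rewrite leqNgt j4.
Qed.

Let t := psi k.
Let u := psi t.
Let v := psi u.

Let psi_k : psi k = t. Proof. by []. Qed.
Let psi_t : psi t = u. Proof. by []. Qed.
Let psi_u : psi u = v. Proof. by []. Qed.

Let psi_v : psi v = k.
Proof.
have: (psi ^+ 4) k = k by rewrite -o_psi expg_order perm1.
by rewrite permX.
Qed.

Let Xt : t \in X. Proof. exact: X_psi. Qed.
Let Xu : u \in X. Proof. exact: X_psi. Qed.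
Let Xv : v \in X. Proof. exact: X_psi. Qed.

Let X_free x : x \in X -> [/\ psi x != x, psi (psi x) != x & psi (psi (psi x)) != x].
Proof.
by move=> Xx; split; [apply: (psi_free (j := 1)) | have:= psi_free (j := 2) Xx isT
  | have:= psi_free (j := 3) Xx isT]; rewrite ?permX.
Qed.

Let X_C : X :\: [set k; t] = C :\ 1.
Proof.
apply/esym/eqP; rewrite eqEcard; apply/andP; split.
  apply/subsetP=> c C1c; rewrite !inE (subsetP CX _ C1c) andbT negb_or.
  move: C1c; rewrite inE => /andP[_ Cc].
  by apply/andP; split; apply: contraTneq Cc => ->.
rewrite cardsD (setIidPr _); last by apply/subsetP=> x /set2P[]->.
have [tk _ _] := X_free Xk.
by rewrite X4 cards2 eq_sym tk; have := cardsD1 1 C; rewrite C3 group1 add1n => -[<-].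
Qed.

Let uC : u \in C /\ u != 1.
Proof.
have: u \in C :\ 1.
  have [_ uk _] := X_free Xk; have [ut _ _] := X_free Xt.
  by rewrite -X_C !inE Xu (negPf uk) (negPf ut).
by rewrite !inE => /andP[].
Qed.

Let vC : v \in C /\ v != 1.
Proof.
have: v \in C :\ 1.
  have [_ _ vk] := X_free Xk; have [_ vt _] := X_free Xt.
  by rewrite -X_C !inE Xv (negPf vk) (negPf vt).
by rewrite !inE => /andP[].
Qed.

Let v_neq_u : v != u. Proof. by have [] := X_free Xu. Qed.

Let C_uv : C :=: [set 1; u; v].
Proof.
have [Cu u1] := uC; have [Cv v1] := vC.
apply/esym/eqP; rewrite eqEcard C3; apply/andP; split.
  by apply/subsetP=> c; rewrite !inE -orbA => /or3P[]/eqP->.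
by rewrite setUC cardsU1 cards2 !inE negb_or v1 v_neq_u eq_sym u1.
Qed.

Let uv : u * v = 1.
Proof.
have [Cu u1] := uC; have [Cv v1] := vC.
have: u * v \in C by rewrite groupM.
rewrite C_uv !inE -orbA => /or3P[/eqP//|/eqP|/eqP].
  by rewrite -{2}[u]mulg1 => /mulgI/eqP; rewrite (negPf v1).
by rewrite -{2}[v]mul1g => /mulIg/eqP; rewrite (negPf u1).
Qed.

Let vu : v * u = 1.
Proof.
have [Cu _] := uC; have [Cv _] := vC; case: dihC => cycC _ _.
by rewrite -uv; apply: (centsP (cyclic_abelian cycC)).
Qed.

Let uu : u * u = v.
Proof.
have [Cu u1] := uC; have [Cv v1] := vC.
have: u * u \in C by rewrite groupM.
rewrite C_uv !inE -orbA => /or3P[|/eqP|/eqP//].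
  by rewrite -uv (inj_eq (mulgI u)) eq_sym (negPf v_neq_u).
by rewrite -{3}[u]mulg1 => /mulgI/eqP; rewrite (negPf u1).
Qed.

Let vv : v * v = u.
Proof. by rewrite -{1}uu -mulgA uv mulg1. Qed.

Let kk : k * k = 1. Proof. exact: (refl_sqr dihC Ck). Qed.

(** If [k * t = u], then [psi t = psi (k * u) = t * v] would be a reflection, whereas
    [psi t = u]. *)
Let kt : k * t = v.
Proof.
have: k * t \in C by apply: (refl_mul dihC).
rewrite C_uv !inE -orbA => /or3P[/eqP kt|/eqP kt|/eqP//].
  have [tk _ _] := X_free Xk; case/eqP: tk; apply: (mulgI k).
  by rewrite -/t kt kk.
have: psi t \in C by have [] := uC.
have ->: t = k * u by rewrite -kt mulgA kk mul1g.
rewrite (elimT (skew_kerP _ psi1) ker_k) groupMr ?(negPf Ct) //.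
by have [] := vC.
Qed.

Let X_enum x : x \in X -> [\/ x = k, x = t, x = u | x = v].
Proof.
move=> Xx; have [xkt|xkt] := boolP (x \in [set k; t]).
  by case/set2P: xkt => ->; [constructor 1 | constructor 2].
have: x \in C :\ 1 by rewrite -X_C inE xkt.
rewrite in_setD1 C_uv !inE => /andP[/negPf->] /=.
by case/orP=> /eqP->; [constructor 3 | constructor 4].
Qed.

Let inv_u : u^-1 = v. Proof. by apply/eqP; rewrite eq_invg_mul uv. Qed.
Let inv_v : v^-1 = u. Proof. by apply/eqP; rewrite eq_invg_mul vu. Qed.
Let inv_k : k^-1 = k. Proof. exact: (refl_inv dihC). Qed.
Let inv_t : t^-1 = t. Proof. exact: (refl_inv dihC). Qed.

Let label d := (val d).1^-1 * (val d).2.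

Let labelX d : label d \in X. Proof. exact: (valP d). Qed.

Let dart_eq d d' : (val d).1 = (val d').1 -> label d = label d' -> d = d'.
Proof.
move=> eq1; rewrite /label eq1 => /mulgI eq2; apply: val_inj.
by case: (val d) (val d') eq1 eq2 => [? ?] [? ?] /= -> ->.
Qed.

Let rot_dart d : (val (cm_rot M d)).1 = (val d).1 /\ label (cm_rot M d) = psi (label d).
Proof. by rewrite permE /label /= mulKg (psi_p (labelX d)). Qed.

Let rev_dart d :
  (val (cm_rev M d)).1 = (val d).1 * label d /\ label (cm_rev M d) = (label d)^-1.
Proof. by rewrite permE /label /= mulKVg invMg invgK. Qed.

Let face_dart d : (val ((cm_rev M * cm_rot M) d)).1 = (val d).1 * label d /\
  label ((cm_rev M * cm_rot M) d) = psi (label d)^-1.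
Proof.
rewrite permM; have [-> ->] := rot_dart (cm_rev M d).
by have [-> ->] := rev_dart d.
Qed.

Let rot_orbit d : #|porbit (cm_rot M) d| = 4.
Proof.
have rotX j : (val ((cm_rot M ^+ j) d)).1 = (val d).1 /\
    label ((cm_rot M ^+ j) d) = (psi ^+ j) (label d).
  elim: j => [|j [IH1 IH2]]; first by rewrite !perm1.
  by rewrite !expgSr !permM; have [-> ->] := rot_dart ((cm_rot M ^+ j) d); rewrite IH2.
apply: card_porbit_min => //.
  have [E1 E2] := rotX 4; apply: dart_eq => //.
  by rewrite E2 -o_psi expg_order perm1.
move=> j lt_j; have [_ E2] := rotX j; apply: contraTneq (psi_free (labelX d) lt_j).
by rewrite -E2 => ->; rewrite eqxx.
Qed.

Let label_neq1 d : label d != 1.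
Proof. by apply: contraNneq X_not1 => <-. Qed.

Let rev_orbit d : #|porbit (cm_rev M) d| = 2.
Proof.
apply: card_porbit_min => // [|[|[|]] //].
  rewrite permX /=; have [E1 E2] := rev_dart (cm_rev M d); have [F1 F2] := rev_dart d.
  by apply: dart_eq; rewrite ?E1 ?E2 F2 ?F1 ?invgK ?mulgK.
move=> _; rewrite expg1; apply/eqP=> eq_d; have [] := rev_dart d; rewrite eq_d.
by rewrite -{1}[(val d).1]mulg1 => /mulgI/esym/eqP; rewrite (negPf (label_neq1 d)).
Qed.

(** Along a face the labels run cyclically through [k, t, u] or stay at [v]; three successive labels
    multiply to [1], fewer do not. *)
Let face_orbit d : #|porbit (cm_rev M * cm_rot M) d| = 3.
Proof.
set f := cm_rev M * cm_rot M.
have [A1 A2] := face_dart d; have [B1 B2] := face_dart (f d).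
have [D1 D2] := face_dart (f (f d)); rewrite -/f in A1 A2 B1 B2 D1 D2.
have [C_u _] := uC; have [C_v _] := vC.
have tE : t = k * v by rewrite -kt mulgA kk mul1g.
have ktu : k * t * u = 1 by rewrite kt vu.
have step : label (f (f (f d))) = label d /\ label d * label (f d) * label (f (f d)) = 1.
  rewrite D2 B2 A2; case: (X_enum (labelX d)) => ->;
    rewrite !(inv_k, inv_t, inv_u, inv_v, psi_k, psi_t, psi_u, psi_v); split=> //.
  - by rewrite tE -!mulgA (mulgA v) vu mul1g kk.
  - by rewrite -mulgA kt uv.
  by rewrite vv uv.
have step2 : label d * label (f d) != 1.
  rewrite A2; case: (X_enum (labelX d)) => ->;
    rewrite !(inv_k, inv_t, inv_u, inv_v, psi_k, psi_t, psi_u, psi_v).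
  - by rewrite kt; have [] := vC.
  - by apply: contraNneq Ct => tu; rewrite -/t -(groupMr _ C_u) tu group1.
  - by apply: contraNneq Ck => uk; rewrite -(groupMl _ C_u) uk group1.
  by rewrite vv; have [] := uC.
apply: card_porbit_min => // [|[|[|[|]]] //].
- rewrite permX /=; case: step => E1 E2; apply: dart_eq => //.
  by rewrite D1 B1 A1 -[RHS]mulg1 -E2 !mulgA.
- move=> _; rewrite expg1; apply/eqP=> eq_d; move: A1; rewrite eq_d.
  by rewrite -{1}[(val d).1]mulg1 => /mulgI/esym/eqP; rewrite (negPf (label_neq1 d)).
move=> _; rewrite permX /=; apply/eqP=> eq_d; move: B1; rewrite eq_d A1 -mulgA.
by rewrite -{1}[(val d).1]mulg1 => /mulgI/esym/eqP; rewrite (negPf step2).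
Qed.

Let card_dart : #|{: cm_dart M}| = 24.
Proof.
rewrite card_sig; have ->: 24%N = #|setX [set: gT] X|.
  by rewrite cardsX cardsT card_gT X4.
have inj : injective (fun p : gT * gT => (p.1, p.1 * p.2)).
  by move=> [g x] [h y] /= [-> /mulgI->].
rewrite -(card_imset _ inj); apply: eq_card => -[g h]; rewrite inE.
apply/idP/imsetP => [Xgh | [[g' x]]].
  by exists (g, g^-1 * h); rewrite ?inE //= mulKVg.
by rewrite inE /= => /andP[_ Xx] [-> ->]; rewrite /cm_adj /= mulKg.
Qed.

(** The only nontrivial element outside [X]: the pairs [g], [g * y] are the antipodal vertices. *)
Let y := k * u.

Let Cy : y \notin C.
Proof. by rewrite groupMr //; have [] := uC. Qed.

Let X_y : X = ~: [set 1; y].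
Proof.
apply/eqP; rewrite eqEcard; apply/andP; split.
  apply/subsetP=> x Xx; rewrite !inE negb_or; apply/andP; split.
    by apply: contraNneq X_not1 => <-.
  have [_ u1] := uC; case: (X_enum Xx) => ->.
  - by rewrite -{1}[k]mulg1 (inj_eq (mulgI k)) eq_sym.
  - by rewrite -(inj_eq (mulgI k)) kt mulgA kk mul1g.
  - by apply: contraNneq Cy => <-; have [] := uC.
  by apply: contraNneq Cy => <-; have [] := vC.
rewrite cardsCs setCK card_gT cards2 X4.
by have ->: 1 != y by apply: contraNneq Cy => <-; apply: group1.
Qed.

Let o_u : #[u] = 3.
Proof.
have [_ u1] := uC; apply: nt_prime_order => //.
by rewrite expgS expgS expg1 uu uv.
Qed.

Lemma skew_octahedron : cm_spherical_octahedron M.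
Proof.
split.
  have:= card_porbits_uniform rot_orbit; have:= card_porbits_uniform rev_orbit.
  have:= card_porbits_uniform face_orbit; rewrite card_dart /cm_spherical.
  set F := #|_|; set E := #|_|; set V := #|_|; move=> HF HE HV.
  have -> : F = 8 by apply/eqP; rewrite -(eqn_pmul2r (isT : (0 < 3)%N)) HF.
  have -> : E = 12 by apply/eqP; rewrite -(eqn_pmul2r (isT : (0 < 2)%N)) HE.
  by have -> : V = 6 by apply/eqP; rewrite -(eqn_pmul2r (isT : (0 < 4)%N)) HV.
have yy : y * y = 1 by apply: (refl_sqr dihC).
have [Cu _] := uC.
(* Axis [i] is the left coset of [{1, y}] at [u ^+ i]; the sign is a boolean read as an exponent. *)
pose e (p : 'I_3 * bool) := u ^+ p.1 * y ^+ p.2.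
have e_C p : (e p \in C) = ~~ p.2.
  rewrite groupMl; last by rewrite groupX.
  by case: p => i [] /=; [rewrite expg1 (negPf Cy) | rewrite expg0 group1].
have e_inj : injective e.
  move=> [i p] [j q] eq_e; have eq_pq : p = q.
    by apply: negb_inj; rewrite -(e_C (i, p)) -(e_C (j, q)) eq_e.
  move: eq_e; rewrite /e /= eq_pq => /mulIg/eqP.
  rewrite eq_expg_mod_order o_u !modn_small // => /eqP/val_inj->.
  by [].
have e_y p : e p * y = e (p.1, ~~ p.2).
  by rewrite /e -mulgA; case: p => i [] /=; rewrite ?expg1 ?yy ?expg0 ?mul1g.
have [f fK eK] : bijective e.
  by apply: inj_card_bij => //; rewrite card_gT card_prod card_ord card_bool.
exists f; first by exists e.
move=> g h; rewrite /cm_adj /= -/X X_y -[in LHS](eK g) -[in LHS](eK h).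
rewrite /octahedron_adj /= !inE negb_or.
have ->: ((e (f g))^-1 * e (f h) == 1) = (f g == f h).
  by rewrite -(inj_eq (mulgI (e (f g)))) mulKVg mulg1 eq_sym (inj_eq e_inj).
have ->: ((e (f g))^-1 * e (f h) == y) = (((f g).1, ~~ (f g).2) == f h).
  by rewrite -(inj_eq (mulgI (e (f g)))) mulKVg e_y eq_sym (inj_eq e_inj).
case: (f g) (f h) => i p [j q]; rewrite !xpair_eqE /= -negb_or -andb_orr.
by case: p q => [] []; rewrite /= ?andbT ?andbF ?orbF.
Qed.

End Octahedron.

(** * Translation to Cayley maps *)

Theorem theorem4p3 (gT : finGroupType) (n : nat) (a b : gT)
    (M : cayley_map gT) (psi : {perm gT}) (pw : gT -> nat)
    (hn : (2 <= n)%N)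
    (hD : dihedral_presentation n a b)
    (hM : cm_regular M)
    (hpsi : associated_skew_morphism M psi pw) :
  (group_set (power_ker pw) /\ power_ker pw :&: ([set: gT] :\: <[a]>) != set0) /\
  ((cm_spherical_octahedron M /\ #|power_ker pw| = 2%N) \/
   (4 <= #|power_ker pw|)%N).
Proof.
have [[psi1 pw_bound pw_skew] psi_p] := hpsi.
have [dihC card_a] := dihedral_presentation_over hn hD.
have cof_pw g : skew_cof psi g = psi ^+ pw g.
  by apply/permP=> h; rewrite skew_cofE pw_skew mulKg.
have psi_skew : skew_perm psi by split=> // g; rewrite cof_pw mem_cycle.
have ker_pw : power_ker pw = skew_ker psi.
  apply/setP=> g; rewrite !inE cof_pw -[X in _ = (_ == X)]expg1 eq_expg_mod_order.
  have /andP[pw1 pw_le] := pw_bound g.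
  apply/eqP/eqP=> [-> //|eq_mod].
  (* Exponents start at 1, so the exponent [#[psi]] stands for the identity; it is congruent to 1
     only if [#[psi] = 1]. *)
  have [lt_pw|eq_pw] : (pw g < #[psi])%N \/ pw g = #[psi].
  - by move: pw_le; rewrite leq_eqVlt => /orP[/eqP|]; [right | left].
  - have lt1 : (1 < #[psi])%N by apply: leq_ltn_trans pw1 lt_pw.
    by move: eq_mod; rewrite !modn_small.
  move: eq_mod; rewrite eq_pw modnn; case: #[psi] (order_gt0 psi) => // -[|m] _ //.
have X_orbit : generating_orbit psi (cm_set M).
  have [p_on porbit_p] := cm_cyclic M; split; [exact: cm_gen | exact: cm_not1 |].
  move=> x Xx; have pX i : (psi ^+ i) x = (cm_perm M ^+ i) x /\ (psi ^+ i) x \in cm_set M.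
    elim: i => [|i [IH1 IH2]]; first by rewrite !perm1.
    by rewrite !expgSr !permM -IH1 psi_p // perm_closed.
  rewrite -(porbit_p x Xx); apply/setP=> y.
  by apply/porbitP/porbitP=> -[i ->]; exists i; have [-> _] := pX i.
have C_gt1 : (1 < #|<[a]>|)%N by rewrite card_a.
have [[g Kg Cg] card_ker] := skew_dihedral_kernel dihC C_gt1 psi_skew X_orbit.
rewrite ker_pw; split.
  split; first exact: skew_ker_group_set.
  by apply/set0Pn; exists g; rewrite inE Kg inE Cg in_setT.
case: card_ker => [|[card2 [k [Ck ker_k [C3 X4 CX] Xk Ct]]]]; [by right | left].
split=> //; apply: (skew_octahedron dihC psi_skew X_orbit psi_p Ck) => //.
by rewrite ker_k !inE eqxx orbT.
Qed.
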